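(* Let $n\ge 1$ be an integer, let $\alpha>0$ and $\beta>1$ be real numbers, and let $q$ be a real number with $q>\max\{\beta,\, n(\beta-1)/\alpha\}$. Let $u\in L^{q}(\mathbf{R}^{n})$ be a positive solution of the integral equation $$u=g_{\alpha}\ast u^{\beta}\quad\text{on } \mathbf{R}^n,$$ where $g_\alpha$ is the Bessel kernel. Then $u$ is radially symmetric and monotone decreasing about some point; that is, there exist a point $x_0\in\mathbf{R}^n$ and a monotone decreasing function $\varphi$ (meaning $\varphi(r)\ge\varphi(s)$ whenever $r\le s$) such that $u(x)=\varphi(|x-x_0|)$ for all $x\in\mathbf{R}^n$.
   Context: For $\alpha>0$, the Bessel kernel on $\mathbf{R}^n$ is $$g_{\alpha}(x)=\frac{1}{\gamma(\alpha)}\int_{0}^{\infty}\exp(-\pi|x|^{2}/\delta)\exp(-\delta/4\pi)\,\delta^{(-n+\alpha)/2}\,\frac{d\delta}{\delta},\qquad \gamma(\alpha)=(4\pi)^{\alpha/2}\Gamma(\alpha/2).$$ The symbol $\ast$ denotes convolution on $\mathbf{R}^n$. A positive solution of $u=g_\alpha\ast u^\beta$ is a measurable function $u:\mathbf{R}^n\to(0,\infty)$ such that $u(x)=\int_{\mathbf{R}^n}g_\alpha(x-y)\,u(y)^\beta\,dy$ for every $x\in\mathbf{R}^n$. *)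

(* Defs.v *)
From HB Require Import structures.
From mathcomp Require Import all_boot all_order all_algebra.
From mathcomp Require Import all_classical all_reals all_analysis.

Set Implicit Arguments.
Unset Strict Implicit.
Unset Printing Implicit Defensive.

Import Order.TTheory GRing.Theory Num.Theory.
Import numFieldNormedType.Exports.

Local Open Scope classical_set_scope.
Local Open Scope ring_scope.

(* R^n is the type 'rV[R]_n of row vectors. Its library norm `|x| is the
   sup norm; the Euclidean norm is enorm below. *)

Definition rV_display : measure_display.
Proof. exact: default_measure_display. Qed.

Section measurable_rV.
Context (R : realType) (n : nat).

(* 'rV[R]_n carries the sigma-algebra generated by the coordinates, i.e. the
   Borel sigma-algebra of R^n. *)
Let coord (i : 'I_n) (x : 'rV[R]_n) : measurableTypeR R := x ord0 i.

Let rV_set0 : g_sigma_preimage coord set0.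
Proof. exact: sigma_algebra0. Qed.

Let rV_setC A : g_sigma_preimage coord A -> g_sigma_preimage coord (~` A).
Proof. exact: sigma_algebraC. Qed.

Let rV_bigcup (F : _^nat) : (forall i, g_sigma_preimage coord (F i)) ->
  g_sigma_preimage coord (\bigcup_i (F i)).
Proof. exact: sigma_algebra_bigcup. Qed.

HB.instance Definition _ := @isMeasurable.Build rV_display
  'rV[R]_n (g_sigma_preimage coord) rV_set0 rV_setC rV_bigcup.

Lemma measurable_coord (i : 'I_n) :
  measurable_fun [set: 'rV[R]_n] (fun x => x ord0 i : measurableTypeR R).
Proof.
move=> _ Y mY; rewrite setTI; apply: sub_sigma_algebra => /=.
rewrite -bigcup_seq/=; exists i => /=; first by rewrite mem_index_enum.
by exists Y => //; rewrite setTI.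
Qed.


Lemma measurable_rVP d (T : measurableType d) (f : T -> 'rV[R]_n) :
  (forall i, measurable_fun [set: T] (fun t => f t ord0 i : measurableTypeR R)) ->
  measurable_fun [set: T] f.
Proof.
move=> mf.
suff : g_sigma_preimage (fun i => coord i \o f) `<=` measurable.
  by rewrite g_sigma_preimage_comp => prefS _ A mA; apply: prefS; exists A.
apply: smallest_sub; first exact: sigma_algebra_measurable.
rewrite -bigcup_seq/=; apply: bigcup_sub => i _ A [B mB <-].
exact: mf.
Qed.

End measurable_rV.

Section lebesgue_rV.
Context (R : realType).

Definition rV_cons n (p : measurableTypeR R * 'rV[R]_n) : 'rV[R]_n.+1 :=
  @row_mx R 1 1 n (p.1)%:M p.2.

Lemma rV_cons0 n (p : measurableTypeR R * 'rV[R]_n) :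
  rV_cons p ord0 ord0 = p.1.
Proof.
rewrite /rV_cons (_ : ord0 = @lshift 1 n ord0); last exact/val_inj.
by rewrite (row_mxEl (p.1)%:M p.2) mxE eqxx.
Qed.

Lemma rV_consS n (p : measurableTypeR R * 'rV[R]_n) (i : 'I_n) :
  rV_cons p ord0 (lift ord0 i) = p.2 ord0 i.
Proof.
rewrite /rV_cons (_ : lift ord0 i = @rshift 1 n i); last exact/val_inj.
by rewrite (row_mxEr (p.1)%:M p.2).
Qed.

Lemma measurable_rV_cons n : measurable_fun setT (@rV_cons n).
Proof.
apply: measurable_rVP => i; have [->|[j ->]] : i = ord0 \/ exists j, i = lift ord0 j.
  by case: (unliftP ord0 i) => [j|] ->; [right; exists j|left].
  by under eq_fun do rewrite rV_cons0; exact: measurable_fst.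
under eq_fun do rewrite rV_consS.
exact: (measurableT_comp (measurable_coord j) measurable_snd).
Qed.

Definition rV_uncons n (x : 'rV[R]_n.+1) : measurableTypeR R * 'rV[R]_n :=
  (x ord0 ord0, \row_j x ord0 (lift ord0 j)).

Lemma rV_consK n : cancel (@rV_cons n) (@rV_uncons n).
Proof.
case=> a v; rewrite /rV_uncons rV_cons0; congr pair.
by apply/rowP => j; rewrite mxE rV_consS.
Qed.

Lemma measurable_rV_uncons n : measurable_fun setT (@rV_uncons n).
Proof.
apply/measurable_fun_pairP; split; first exact: measurable_coord.
apply: measurable_rVP => i.
under eq_fun do rewrite /= mxE.
exact: measurable_coord.
Qed.

Section step.
Context (n : nat) (m : {sigma_finite_measure set 'rV[R]_n -> \bar R}).

Definition lebesgue_rV_step : set 'rV[R]_n.+1 -> \bar R :=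
  pushforward (@lebesgue_measure R \x m)%E (@rV_cons n).

Let pm : {measure set 'rV[R]_n.+1 -> \bar R} :=
  measure_function_pushforward__canonical__measure_function_Measure
    (@lebesgue_measure R \x m)%E (@measurable_rV_cons n).

HB.instance Definition _ := isMeasure.Build _ _ _ lebesgue_rV_step
  (measure0 pm) (measure_ge0 pm) (@measure_semi_sigma_additive _ _ _ pm).

Let step_sigma_finite : sigma_finite setT lebesgue_rV_step.
Proof.
have /sigma_finiteP[F [TF ndF Foo]] := sigma_finiteT (@lebesgue_measure R).
have /sigma_finiteP[G [TG ndG Goo]] := sigma_finiteT m.
exists (fun k => @rV_uncons n @^-1` (F k `*` G k)).
  rewrite -preimage_bigcup (_ : \bigcup_k _ = setT) ?preimage_setT//.
  rewrite -subTset => -[a v] _.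
  have [k _ Fka] : (\bigcup_k F k) a by rewrite -TF.
  have [l _ Glv] : (\bigcup_k G k) v by rewrite -TG.
  exists (maxn k l) => //; split.
    by move: a Fka; exact/subsetPset/ndF/leq_maxl.
  by move: v Glv; exact/subsetPset/ndG/leq_maxr.
move=> k; have [mF Fk] := Foo k; have [mG Gk] := Goo k; split.
  rewrite -[X in measurable X]setTI.
  by apply: measurable_rV_uncons => //; exact: measurableX.
rewrite /lebesgue_rV_step /pushforward -comp_preimage (_ : _ \o _ = id).
  rewrite preimage_id product_measure1E//.
  by rewrite lte_mul_pinfty// ge0_fin_numE.
by apply/funext => p /=; rewrite rV_consK.
Qed.

HB.instance Definition _ :=
  @Measure_isSigmaFinite.Build _ _ _ lebesgue_rV_step step_sigma_finite.

End step.

(* Lebesgue measure on the Borel sets of R^n: the n-fold product of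
   lebesgue_measure, carried over from R * R^k to R^(k+1) by rV_cons. *)
Fixpoint lebesgue_rV n : {sigma_finite_measure set 'rV[R]_n -> \bar R} :=
  if n is k.+1 then lebesgue_rV_step (lebesgue_rV k) else \d_(0 : 'rV[R]_0).

Lemma lebesgue_rV_box n (A : 'I_n -> set (measurableTypeR R)) :
  (forall i, measurable (A i)) ->
  lebesgue_rV n [set x | forall i, A i (x ord0 i)] =
  (\prod_(i < n) @lebesgue_measure R (A i))%E.
Proof.
elim: n A => [|n IH] A mA /=.
  by rewrite big_ord0 diracE mem_set// => -[].
pose B := [set x : 'rV[R]_n | forall i, A (lift ord0 i) (x ord0 i)].
have mB : measurable B.
  rewrite (_ : B = \bigcap_(i in [set: 'I_n])
    ((fun x : 'rV[R]_n => x ord0 i : measurableTypeR R) @^-1` A (lift ord0 i))).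
    apply: fin_bigcap_measurable => // i _.
    by rewrite -[X in measurable X]setTI; exact: measurable_coord.
  by apply/seteqP; split => x /= Bx i => [_|]; exact: Bx.
rewrite big_ord_recl -IH// -[X in (_ * X)%E]/(lebesgue_rV n B).
rewrite -product_measure1E// /lebesgue_rV_step /pushforward; congr (_ _).
apply/seteqP; split=> [p /= Ap|p [/= Ap1 Ap2] i].
  split; first by have := Ap ord0; rewrite rV_cons0.
  by move=> i; have := Ap (lift ord0 i); rewrite rV_consS.
case: (unliftP ord0 i) => [j|] ->; last by rewrite rV_cons0.
by rewrite rV_consS; exact: Ap2.
Qed.

End lebesgue_rV.

(* The Lebesgue sigma-algebra of R^n, on a copy of 'rV[R]_n: the sets that are
   Caratheodory-measurable for the Lebesgue outer measure. *)
Notation lebesgue_type R n := (caratheodory_type (lebesgue_rV R n)^*%mu).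

Definition completed_lebesgue_rV (R : realType) (n : nat) :
    {measure set (lebesgue_type R n) -> \bar R} :=
  @completed_measure_extension _ _ _ (lebesgue_rV R n).

Definition enorm (R : realType) (n : nat) (x : 'rV[R]_n) : R :=
  Num.sqrt (\sum_(i < n) x ord0 i ^+ 2).

Definition Gamma (R : realType) (s : R) : R :=
  \int[@lebesgue_measure R]_(t in `]0, +oo[) (t `^ (s - 1) * expR (- t)).

Definition bessel_gamma (R : realType) (alpha : R) : R :=
  (4 * pi) `^ (alpha / 2) * Gamma (alpha / 2).

(* Extended-real valued: the integral diverges at x = 0 when alpha <= n. *)
Definition bessel_kernel (R : realType) (n : nat) (alpha : R) (x : 'rV[R]_n) :
    \bar R :=
  ((bessel_gamma alpha)^-1%:E *
   \int[@lebesgue_measure R]_(delta in `]0%R, +oo[)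
     (expR (- pi * enorm x ^+ 2 / delta) * expR (- delta / (4 * pi)) *
      delta `^ ((- n%:R + alpha) / 2) / delta)%:E)%E.

Definition positive_solution (R : realType) (n : nat) (alpha beta : R)
    (u : lebesgue_type R n -> R) : Prop :=
  [/\ measurable_fun [set: lebesgue_type R n] u,
      forall x, 0 < u x &
      forall x : 'rV[R]_n,
        ((u x)%:E = \int[completed_lebesgue_rV R n]_y
                     (bessel_kernel alpha (x - y) * (u y `^ beta)%:E))%E].

(* Main.v *)
Require Import Defs.
From HB Require Import structures.
From mathcomp Require Import all_boot all_order all_algebra.
From mathcomp Require Import all_classical all_reals all_analysis.
From mathcomp Require Import measurable_realfun ring lra.

Set Implicit Arguments.
Unset Strict Implicit.
Unset Printing Implicit Defensive.

Import Order.TTheory GRing.Theory Num.Theory.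
Import numFieldNormedType.Exports.

Local Open Scope classical_set_scope.
Local Open Scope ring_scope.

(* The proof uses moving planes in integral form. Let T be the reflection in a
   hyperplane and E the part of one of its half-spaces where u exceeds u o T.
   Folding the integral over T, and since g_alpha is radially decreasing,
     u - u o T <= beta g_alpha * (1_E u^(beta-1) (u - u o T))   on E.
   The hypothesis q > n (beta - 1) / alpha says that g_alpha lies in L^s
   for s = q / (q - beta + 1), so Young's inequality bounds the L^q(E) norm of
   u - u o T by a constant times ||u||_{L^q(E)}^(beta-1) times itself: E is empty
   as soon as it carries little of the mass of u^q. This starts the motion of the
   plane from infinity. It can only stop at a plane of symmetry: if u < u o T
   strictly at the limit position, the mass of u^q in the sets E of nearby positions
   tends to 0, so that the plane can be moved further. Continuity of u is not
   available, but Fatou's lemma makes u lower semicontinuous, which suffices for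
   both limits. Since u is a positive element of L^q it is not invariant under any
   translation, so the planes of symmetry of all directions meet in one point. *)

(** * Reflections and Lebesgue measure on R^n *)

Section euclid.
Context {R : realType} {n : nat}.
Implicit Types (x y v e : 'rV[R]_n) (a l : R).

Definition dotv x y : R := \sum_(i < n) x ord0 i * y ord0 i.

Lemma dotvC x y : dotv x y = dotv y x.
Proof. by apply: eq_bigr => i _; rewrite mulrC. Qed.

Lemma dotvDl x y v : dotv (x + y) v = dotv x v + dotv y v.
Proof. by rewrite -big_split; apply: eq_bigr => i _; rewrite mxE mulrDl. Qed.

Lemma dotvZl a x y : dotv (a *: x) y = a * dotv x y.
Proof. by rewrite mulr_sumr; apply: eq_bigr => i _; rewrite mxE mulrA. Qed.

Lemma dotvNl x y : dotv (- x) y = - dotv x y.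
Proof. by rewrite -scaleN1r dotvZl mulN1r. Qed.

Lemma dotvDr x y v : dotv v (x + y) = dotv v x + dotv v y.
Proof. by rewrite dotvC dotvDl !(dotvC v). Qed.

Lemma dotvZr a x y : dotv x (a *: y) = a * dotv x y.
Proof. by rewrite dotvC dotvZl dotvC. Qed.

Lemma dotvNr x y : dotv x (- y) = - dotv x y.
Proof. by rewrite dotvC dotvNl dotvC. Qed.

Definition dotvE := (dotvDl, dotvDr, dotvZl, dotvZr, dotvNl, dotvNr).

Definition sqn x : R := dotv x x.

Lemma sqn_ge0 x : 0 <= sqn x.
Proof. by apply: sumr_ge0 => i _; rewrite -expr2 sqr_ge0. Qed.

Lemma sqn_eq0 x : (sqn x == 0) = (x == 0).
Proof.
rewrite /sqn /dotv psumr_eq0 => [|i _]; last by rewrite -expr2 sqr_ge0.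
apply/idP/eqP => [/allP x0|->]; last by apply/allP => i _; rewrite mxE mulr0 eqxx implybT.
apply/rowP => i; have := x0 i; rewrite mem_index_enum mxE => /(_ isT).
by rewrite mulf_eq0 orbb => /eqP.
Qed.

Lemma enormE x : enorm x = Num.sqrt (sqn x).
Proof. by congr Num.sqrt; apply: eq_bigr => i _; rewrite expr2. Qed.

Lemma sqr_enorm x : enorm x ^+ 2 = sqn x.
Proof. by rewrite enormE sqr_sqrtr// sqn_ge0. Qed.

Lemma sqnN x : sqn (- x) = sqn x.
Proof. by rewrite /sqn !dotvE opprK. Qed.

(* Orthogonal reflection in the hyperplane [dotv x e = l], for a unit vector e. *)
Definition refl e l x : 'rV[R]_n := x + (2 * (l - dotv x e)) *: e.

Lemma dotv_refl e l x : sqn e = 1 -> dotv (refl e l x) e = 2 * l - dotv x e.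
Proof. by rewrite /sqn /refl => e1; rewrite !dotvE e1; ring. Qed.

Lemma reflK e l : sqn e = 1 -> involutive (refl e l).
Proof.
move=> e1 x; rewrite {1}/refl dotv_refl//; apply/rowP => i; rewrite !mxE; ring.
Qed.

Lemma refl_sub e l x y : sqn e = 1 ->
  sqn (refl e l x - refl e l y) = sqn (x - y).
Proof.
move=> e1; rewrite (_ : refl e l x - refl e l y = (x - y) - (2 * dotv (x - y) e) *: e).
  move: (x - y) e1 => v; rewrite /sqn !dotvE (dotvC e v) => ->; ring.
rewrite /refl !dotvE; apply/rowP => i; rewrite !mxE; ring.
Qed.

Lemma sqn_sub_refl e l x y : sqn e = 1 ->
  sqn (x - refl e l y) = sqn (x - y) + 4 * (dotv x e - l) * (dotv y e - l).
Proof.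
move=> e1; rewrite /refl opprD addrA; move: e1; rewrite /sqn !dotvE.
rewrite (dotvC e x) (dotvC e y) (dotvC y x) => ->; ring.
Qed.

End euclid.

Section measurable_rV.
Context {R : realType} {n : nat} {d} {T : measurableType d}.
Implicit Types (f g : T -> 'rV[R]_n).

Lemma measurable_addv f g : measurable_fun setT f -> measurable_fun setT g ->
  measurable_fun setT (fun t => f t + g t).
Proof.
move=> mf mg; apply: measurable_rVP => i; under eq_fun do rewrite mxE.
by apply: measurable_funD; apply: (measurableT_comp (measurable_coord i)).
Qed.

Lemma measurable_scalev (k : T -> R) f : measurable_fun setT k ->
  measurable_fun setT f -> measurable_fun setT (fun t => k t *: f t).
Proof.
move=> mk mf; apply: measurable_rVP => i; under eq_fun do rewrite mxE.
by apply: measurable_funM => //; apply: (measurableT_comp (measurable_coord i)).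
Qed.

Lemma measurable_subv f g : measurable_fun setT f -> measurable_fun setT g ->
  measurable_fun setT (fun t => f t - g t).
Proof.
move=> mf mg; apply: measurable_addv => //.
by under eq_fun do rewrite -scaleN1r; exact: measurable_scalev.
Qed.

Lemma measurable_dotv f g : measurable_fun setT f -> measurable_fun setT g ->
  measurable_fun setT (fun t => dotv (f t) (g t)).
Proof.
move=> mf mg; apply: measurable_sum => i.
by apply: measurable_funM; apply: (measurableT_comp (measurable_coord i)).
Qed.

Lemma measurable_refl e l f : measurable_fun setT f ->
  measurable_fun setT (fun t => refl e l (f t)).
Proof.
move=> mf; apply: measurable_addv => //; apply: measurable_scalev => //.
apply: measurable_funM => //; apply: measurable_funB => //.
exact: measurable_dotv.
Qed.

Lemma measurable_sqn f : measurable_fun setT f ->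
  measurable_fun setT (fun t => sqn (f t)).
Proof. by move=> mf; exact: measurable_dotv. Qed.

End measurable_rV.

Section invariance.
Context {R : realType}.
Local Open Scope ereal_scope.

Lemma integral_rV_cons n (f : 'rV[R]_n.+1 -> \bar R) :
  measurable_fun setT f -> (forall x, 0 <= f x) ->
  \int[lebesgue_rV R n.+1]_x f x =
  \int[@lebesgue_measure R]_a \int[lebesgue_rV R n]_v f (rV_cons (a, v)).
Proof.
move=> mf f0; have mc := @measurable_rV_cons R n.
pose pm : {measure set 'rV[R]_n.+1 -> \bar R} :=
  measure_function_pushforward__canonical__measure_function_Measure
    (@lebesgue_measure R \x lebesgue_rV R n) mc.
rewrite (@eq_measure_integral _ _ _ setT pm)//.
rewrite ge0_integral_pushforward// preimage_setT fubini_tonelli1//.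
  exact: (measurableT_comp mf).
by move=> x; exact: f0.
Qed.

Lemma integral_R_shift (f : measurableTypeR R -> \bar R) (c : R) :
  measurable_fun setT f -> (forall x, 0 <= f x) ->
  \int[lebesgue_measure]_x f (x + c)%R = \int[lebesgue_measure]_x f x.
Proof.
move=> mf f0.
have ms : measurable_fun setT
    ((fun x => x + c)%R : measurableTypeR R -> measurableTypeR R).
  exact: measurable_funD.
pose pm : {measure set (measurableTypeR R) -> \bar R} :=
  measure_function_pushforward__canonical__measure_function_Measure
    (@lebesgue_measure R) ms.
rewrite [RHS](@eq_measure_integral _ _ _ setT pm).
  by rewrite ge0_integral_pushforward// preimage_setT.
move=> A mA _; apply: lebesgue_measure_unique => // _ [[a b]] _ <-.
rewrite /pm/= /pushforward.
rewrite (_ : _ @^-1` _ = `](a - c)%R, (b - c)%R]%classic).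
  rewrite !lebesgue_measure_itv/= !lte_fin ltrBlDr subrK -!EFinB.
  by rewrite opprB addrA subrK.
by apply/seteqP; split => x; rewrite /= !in_itv/= ltrBlDr lerBrDr.
Qed.

Lemma integral_rV0 (f : 'rV[R]_0 -> \bar R) :
  measurable_fun setT f ->
  \int[lebesgue_rV R 0]_x f x = f 0%R.
Proof. by move=> mf; rewrite [LHS]integral_dirac// diracT mul1e. Qed.

Lemma integral_rV_shift n (c : 'rV[R]_n) (f : 'rV[R]_n -> \bar R) :
  measurable_fun setT f -> (forall x, 0 <= f x) ->
  \int[lebesgue_rV R n]_x f (x + c)%R = \int[lebesgue_rV R n]_x f x.
Proof.
elim: n c f => [|n IH] c f mf f0.
  by apply: eq_integral => x _; congr f; apply/rowP => -[].
have ma : measurable_fun setT (fun x : 'rV[R]_n.+1 => f (x + c)%R).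
  by apply: (measurableT_comp mf); exact: measurable_addv.
rewrite !integral_rV_cons//; set v := (rV_uncons c).2; set b := c ord0 ord0.
have cD a w : (rV_cons (a, w) + c)%R = rV_cons ((a + b)%R, (w + v)%R).
  apply/rowP => i; rewrite mxE.
  case: (unliftP ord0 i) => [j|] ->; last by rewrite !rV_cons0.
  by rewrite !rV_consS !mxE.
have mfc : measurable_fun setT (f \o @rV_cons R n).
  by apply: measurableT_comp => //; exact: measurable_rV_cons.
under eq_integral => a _.
  under eq_integral => w _ do rewrite cD.
  rewrite (IH v (fun w => f (rV_cons ((a + b)%R, w))))//; last first.
    by apply: (measurableT_comp mfc); exact: measurable_pair1.
  over.
rewrite (@integral_R_shift (fun a => \int[lebesgue_rV R n]_w f (rV_cons (a, w))))//.
- by apply: (measurable_fun_fubini_tonelli_F (f \o @rV_cons R n)) => // x; exact: f0.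
- by move=> x; exact: integral_ge0.
Qed.

End invariance.

Section gauss.
Context {R : realType}.
Local Open Scope ereal_scope.

Lemma measurable_gauss n (k : R) :
  measurable_fun setT (fun x : 'rV[R]_n => (expR (- k * sqn x))%:E).
Proof.
apply/measurable_EFinP; apply: measurableT_comp => //.
by apply: measurable_funM => //; exact: measurable_sqn.
Qed.

Lemma integral_gauss1 (k : R) : (0 < k)%R ->
  \int[@lebesgue_measure R]_x (expR (- k * x ^+ 2))%:E = (Num.sqrt (pi / k))%:E.
Proof.
move=> k0; pose s : R := Num.sqrt (k *+ 2)^-1.
have k2 : (0 < k *+ 2)%R by rewrite mulrn_wgt0.
have s0 : s != 0%R by rewrite gt_eqF// sqrtr_gt0 invr_gt0.
have s2 : (s ^+ 2 *+ 2 = k^-1)%R.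
  rewrite sqr_sqrtr ?invr_ge0 ?ltW// -mulr_natr -[(k *+ 2)%R]mulr_natr.
  by rewrite invfM -mulrA mulVf// mulr1.
have E x : (expR (- k * x ^+ 2) = Num.sqrt (pi / k) * normal_pdf 0 s x)%R.
  rewrite normal_pdfE// /normal_peak /normal_fun subr0 -mulrnAl s2 invrK.
  rewrite (mulrC k^-1%R) [RHS]mulrA divff ?mul1r; last first.
    by rewrite gt_eqF// sqrtr_gt0 divr_gt0// pi_gt0.
  by congr expR; rewrite mulNr mulrC -mulNr.
under eq_integral do rewrite E EFinM.
rewrite ge0_integralZl//; last 2 first.
  by apply/measurable_EFinP; exact: measurable_normal_pdf.
  by move=> x _; rewrite lee_fin normal_pdf_ge0.
by rewrite integral_normal_pdf mule1.
Qed.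

Lemma sqn_cons n a (v : 'rV[R]_n) : sqn (rV_cons (a, v)) = (a ^+ 2 + sqn v)%R.
Proof.
rewrite /sqn /dotv big_ord_recl rV_cons0; congr (_ + _)%R.
by apply: eq_bigr => i _; rewrite rV_consS.
Qed.

Lemma integral_gauss n (k : R) : (0 < k)%R ->
  \int[lebesgue_rV R n]_x (expR (- k * sqn x))%:E = (Num.sqrt (pi / k) ^+ n)%:E.
Proof.
move=> k0; elim: n => [|n IH].
  rewrite integral_rV0; last exact: (measurable_gauss k).
  by rewrite /sqn /dotv big_ord0 mulr0 expR0 expr0.
rewrite integral_rV_cons; last 2 first.
- exact: (measurable_gauss k).
- by move=> x; rewrite lee_fin expR_ge0.
under eq_integral => a _.
  under eq_integral => v _ do rewrite sqn_cons mulrDr expRD EFinM.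
  rewrite ge0_integralZl//; last exact: (measurable_gauss k).
  over.
rewrite IH ge0_integralZr//; last first.
  apply/measurable_EFinP; apply: measurableT_comp => //.
  by apply: measurable_funM => //; exact: exprn_measurable.
by rewrite integral_gauss1// -EFinM exprS.
Qed.

End gauss.

Section reflection_invariance.
Context {R : realType} {n : nat}.
Local Open Scope ereal_scope.
Notation mu := (lebesgue_rV R n).

(* Integrating [phi x * f (T y)] over (x, y), with phi a Gaussian and T the
   reflection, and using only translation invariance and Tonelli's theorem,
   gives the result up to the factor [\int phi], which is positive and finite. *)
Lemma integral_refl e l (f : 'rV[R]_n -> \bar R) : sqn e = 1%R ->
  measurable_fun setT f -> (forall x, 0 <= f x) ->
  \int[mu]_x f (refl e l x) = \int[mu]_x f x.
Proof.
move=> e1 mf f0.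
pose phi (x : 'rV[R]_n) := (expR (- 1 * sqn x))%:E.
have phi0 x : 0 <= phi x by rewrite lee_fin expR_ge0.
have mphi : measurable_fun setT phi by exact: (measurable_gauss 1).
have mfT : measurable_fun setT (fun x => f (refl e l x)).
  by apply: (measurableT_comp mf); exact: measurable_refl.
have refl0 x y : refl e l (y + refl e 0 x)%R = (refl e l y + x)%R.
  rewrite /refl !dotvE; apply/rowP => i; rewrite !mxE.
  move: e1; rewrite /sqn => ->; ring.
have [r r0 cE] : exists2 r : R, r != 0%R & \int[mu]_x phi x = r%:E.
  exists (Num.sqrt (pi / 1) ^+ n)%R; last exact: integral_gauss.
  by rewrite expf_neq0// gt_eqF// sqrtr_gt0 divr1 pi_gt0.
have phiT x y : phi (x - refl e l y)%R = phi (y - refl e l x)%R.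
  rewrite /phi; congr (expR (_ * _))%:E.
  by rewrite -(refl_sub l _ _ e1) reflK// -sqnN opprB.
clearbody phi.
suff /(congr1 (mule r^-1%:E)) : r%:E * \int[mu]_x f (refl e l x) = r%:E * \int[mu]_x f x.
  by rewrite !muleA -EFinM mulVf// !mul1e.
rewrite -cE -ge0_integralZr//; last exact: integral_ge0.
transitivity (\int[mu]_x \int[mu]_y (phi x * f (refl e l y + x)%R)).
  apply: eq_integral => x _; rewrite -ge0_integralZl//.
  rewrite -[LHS](integral_rV_shift (refl e 0 x)); last 2 first.
  - exact: measurable_funeM.
  - by move=> y; rewrite mule_ge0.
  by apply: eq_integral => y _; rewrite refl0.
rewrite (fubini_tonelli (fun p : 'rV[R]_n * 'rV[R]_n =>
  phi p.1 * f (refl e l p.2 + p.1)%R)); last 2 first.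
- apply: emeasurable_funM; first exact: (measurableT_comp mphi).
  apply: (measurableT_comp mf); apply: measurable_addv => //.
  exact: measurable_refl.
- by move=> p; rewrite mule_ge0.
transitivity (\int[mu]_y \int[mu]_x (phi (x - refl e l y)%R * f x)).
  apply: eq_integral => y _.
  rewrite -[RHS](integral_rV_shift (refl e l y)); last 2 first.
  - apply: emeasurable_funM => //; apply: (measurableT_comp mphi).
    by apply: measurable_subv.
  - by move=> x; rewrite mule_ge0.
  by apply: eq_integral => x _; rewrite addrK addrC.
rewrite (fubini_tonelli (fun p : 'rV[R]_n * 'rV[R]_n =>
  phi (p.2 - refl e l p.1)%R * f p.2)); last 2 first.
- apply: emeasurable_funM; last exact: (measurableT_comp mf).
  apply: (measurableT_comp mphi); apply: measurable_subv => //.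
  exact: measurable_refl.
- by move=> p; rewrite mule_ge0.
rewrite -ge0_integralZl//; last by rewrite cE lee_fin -lee_fin -cE integral_ge0.
apply: eq_integral => x _; rewrite /= ge0_integralZr//; last first.
  apply: (measurableT_comp mphi); apply: measurable_subv => //.
  exact: measurable_refl.
congr (_ * _).
rewrite -[RHS](integral_rV_shift (- refl e l x)%R mphi phi0).
by apply: eq_integral => y _; rewrite phiT.
Qed.

Lemma hyperplane_null e l : sqn e = 1%R -> mu [set x | dotv x e = l] = 0.
Proof.
move=> e1.
have mH t : measurable [set x : 'rV[R]_n | dotv x e = t].
  have -> : [set x | dotv x e = t] = (fun x => dotv x e) @^-1` [set t] by [].
  by rewrite -[X in measurable X]setTI; apply: measurable_dotv.
pose D := [set p : measurableTypeR R * 'rV[R]_n | dotv p.2 e = p.1].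
have mD : measurable D.
  have -> : D = (fun p => dotv p.2 e - p.1)%R @^-1` [set 0%R].
    by apply/seteqP; split => p /= => [->|/eqP]; rewrite ?subrr// subr_eq0 => /eqP.
  rewrite -[X in measurable X]setTI; apply: measurable_funB => //.
  exact: measurable_dotv.
have J t : \int[mu]_x (\1_D (t, x))%:E = mu [set x | dotv x e = l].
  rewrite -(integral_rV_shift ((t - l) *: e)); last 2 first.
  - apply/measurable_EFinP; apply: (measurableT_comp (measurable_indic mD)).
    exact: measurable_pair1.
  - by move=> x; rewrite lee_fin.
  rewrite -[X in _ = mu X]setIT -integral_indic//; apply: eq_integral => x _.
  rewrite !indicE; congr (nat_of_bool _)%:R%:E.
  apply/idP/idP; rewrite !inE /D /= dotvDl dotvZl -/(sqn e) e1 mulr1.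
    by move=> h; rewrite -(addrK (t - l)%R (dotv x e)) h opprB addrC subrK.
  by move=> ->; rewrite addrC subrK.
have /eqP : \int[@lebesgue_measure R]_t \int[mu]_x (\1_D (t, x))%:E = 0.
  rewrite (fubini_tonelli (fun p => (\1_D p)%:E)); last 2 first.
  - by apply/measurable_EFinP; exact: measurable_indic.
  - by move=> x; rewrite lee_fin.
  apply: integral0_eq => x _ /=.
  rewrite (_ : (fun t => _) = EFin \o \1_[set dotv x e]).
    by rewrite integral_indic// setIT; exact: lebesgue_measure_set1.
  by apply/funext => t /=; rewrite !indicE /D; congr (nat_of_bool _)%:R%:E;
    apply/idP/idP; rewrite !inE /= => ->.
under eq_integral do rewrite J.
rewrite integral_cst// mule_eq0 => /orP[/eqP//|/eqP].
have := @lebesgue_measure_itv R `]-oo, +oo[; rewrite set_itvNyy /= => ->.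
by [].
Qed.

End reflection_invariance.

(** * Hoelder's inequality and completion *)

Section hoelder_ereal.
Context {d} {T : measurableType d} {R : realType}.
Variable mu : {measure set T -> \bar R}.
Local Open Scope ereal_scope.
Implicit Types (f g h : T -> \bar R) (a b c : R).

Lemma ge0_integral_eq0_ae f : measurable_fun setT f -> (forall x, 0 <= f x) ->
  \int[mu]_x f x = 0 -> {ae mu, forall x, f x = 0}.
Proof.
move=> mf f0 If.
have /ae_eq_integral_abs : \int[mu]_x `|f x| = 0.
  by rewrite -[RHS]If; apply: eq_integral => x _; rewrite gee0_abs.
by move=> /(_ measurableT mf); apply: filterS => x; apply.
Qed.

Lemma ge0_integral_lty_ae f : measurable_fun setT f -> (forall x, 0 <= f x) ->
  \int[mu]_x f x < +oo -> {ae mu, forall x, f x \is a fin_num}.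
Proof.
move=> mf f0 If.
have : mu.-integrable setT f.
  by apply/integrableP; split=> //; under eq_integral do rewrite gee0_abs//.
by move/(integrable_ae measurableT) => h; apply: filterS h => x; apply.
Qed.

Lemma measurable_fun_poweR a f : measurable_fun setT f ->
  measurable_fun setT (fun x => f x `^ a).
Proof. by move=> mf; exact: (measurableT_comp (@measurable_poweR R a)). Qed.

Lemma hoelder_poweR a b f g : (0 < a)%R -> (0 < b)%R -> (a + b = 1)%R ->
  measurable_fun setT f -> measurable_fun setT g ->
  (forall x, 0 <= f x) -> (forall x, 0 <= g x) ->
  \int[mu]_x (f x `^ a * g x `^ b) <=
  (\int[mu]_x f x) `^ a * (\int[mu]_x g x) `^ b.
Proof.
move=> a0 b0 ab mf mg f0 g0.
have nz (r : R) : (0 < r)%R -> r != 0%R by move=> r0; rewrite gt_eqF.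
have mfg : measurable_fun setT (fun x => f x `^ a * g x `^ b).
  by apply: emeasurable_funM; exact: measurable_fun_poweR.
have If0 : 0 <= \int[mu]_x f x by exact: integral_ge0.
have Ig0 : 0 <= \int[mu]_x g x by exact: integral_ge0.
have fg0 : {ae mu, forall x, f x `^ a * g x `^ b = 0} ->
    \int[mu]_x (f x `^ a * g x `^ b) <= (\int[mu]_x f x) `^ a * (\int[mu]_x g x) `^ b.
  move=> h; rewrite (ge0_ae_eq_integral _ mfg (@measurable_cst _ _ _ _ setT 0))//.
  - by rewrite integral0 mule_ge0// poweR_ge0.
  - by move=> x _; rewrite mule_ge0// poweR_ge0.
  - by apply: filterS h => x.
have [If|If] := eqVneq (\int[mu]_x f x) 0.
  apply: fg0; apply: filterS (ge0_integral_eq0_ae mf f0 If) => x ->.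
  by rewrite poweR0r ?mul0e ?nz.
have [Ig|Ig] := eqVneq (\int[mu]_x g x) 0.
  apply: fg0; apply: filterS (ge0_integral_eq0_ae mg g0 Ig) => x ->.
  by rewrite poweR0r ?mule0 ?nz.
have [Ify|Ify] := eqVneq (\int[mu]_x f x) +oo.
  by rewrite Ify poweRyr ?nz// gt0_mulye ?leey// poweR_gt0// lt0e Ig.
have [Igy|Igy] := eqVneq (\int[mu]_x g x) +oo.
  by rewrite Igy poweRyr ?nz// gt0_muley ?leey// poweR_gt0// lt0e If.
have aef := ge0_integral_lty_ae mf f0 (etrans (ltey _) Ify).
have aeg := ge0_integral_lty_ae mg g0 (etrans (ltey _) Igy).
pose F x := (fine (f x) `^ a)%R; pose G x := (fine (g x) `^ b)%R.
have mF : measurable_fun setT F.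
  by apply: (measurableT_comp (@measurable_powR R a)); exact: measurableT_comp.
have mG : measurable_fun setT G.
  by apply: (measurableT_comp (@measurable_powR R b)); exact: measurableT_comp.
have := @hoelder _ _ _ mu F G a^-1 b^-1 mF mG.
rewrite !invr_gt0 !invrK => /(_ a0 b0 ab); rewrite Lnorm1 => hfg.
have E (k : T -> \bar R) c : (0 < c)%R -> measurable_fun setT k ->
    (forall x, 0 <= k x) -> {ae mu, forall x, k x \is a fin_num} ->
    Lnorm mu (c^-1)%:E (fun x => (fine (k x) `^ c)%:E) = (\int[mu]_x k x) `^ c.
  move=> c0 mk k0 aek; rewrite unlock invrK; congr (_ `^ _).
  have kE x : (`|fine (k x) `^ c| `^ c^-1 = fine (k x))%R.
    by rewrite ger0_norm ?powR_ge0// -powRrM mulfV ?nz// powRr1// fine_ge0.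
  under eq_integral do rewrite abse_EFin poweR_EFin kE.
  apply: ge0_ae_eq_integral => //.
  - by apply/measurable_EFinP; exact: measurableT_comp.
  - by move=> x _; rewrite lee_fin fine_ge0.
  - by apply: filterS aek => x kx _; rewrite fineK.
rewrite -(E f)// -(E g)//; apply: le_trans hfg.
rewrite le_eqVlt; apply/orP; left; apply/eqP.
apply: ge0_ae_eq_integral => //.
- by apply/measurable_EFinP; apply: measurableT_comp => //; exact: measurable_funM.
- by move=> x _; rewrite mule_ge0// poweR_ge0.
- apply: filterS2 aef aeg => x fx gx _ /=.
  rewrite ger0_norm ?mulr_ge0 ?powR_ge0// EFinM /F /G -!poweR_EFin !fineK//.
Qed.

Lemma hoelder3_poweR a b c f g h : (0 < a)%R -> (0 < b)%R -> (0 < c)%R ->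
  (a + b + c = 1)%R -> measurable_fun setT f -> measurable_fun setT g ->
  measurable_fun setT h ->
  (forall x, 0 <= f x) -> (forall x, 0 <= g x) -> (forall x, 0 <= h x) ->
  \int[mu]_x (f x `^ a * (g x `^ b * h x `^ c)) <=
  (\int[mu]_x f x) `^ a * ((\int[mu]_x g x) `^ b * (\int[mu]_x h x) `^ c).
Proof.
move=> a0 b0 c0 abc mf mg mh f0 g0 h0.
have bc0 : (0 < b + c)%R by rewrite addr_gt0.
have E x y : 0 <= x -> 0 <= y ->
    x `^ b * y `^ c = (x `^ (b / (b + c)) * y `^ (c / (b + c))) `^ (b + c).
  move=> x0 y0; rewrite poweRM ?poweR_ge0// -!poweRrM.
  by rewrite -!mulrA mulVf ?mulr1 ?gt_eqF.
under eq_integral do rewrite E//.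
rewrite E ?integral_ge0//.
apply: le_trans (hoelder_poweR a0 bc0 _ mf _ f0 _) _ => //.
- by rewrite addrA.
- by apply: emeasurable_funM; exact: measurable_fun_poweR.
- by move=> x; rewrite mule_ge0// poweR_ge0.
apply: lee_wpmul2l; first exact: poweR_ge0.
apply: gt0_ler_poweR; first exact: ltW.
- by rewrite in_itv/= leey andbT integral_ge0// => x _; rewrite mule_ge0// poweR_ge0.
- by rewrite in_itv/= leey andbT mule_ge0// poweR_ge0.
apply: hoelder_poweR => //; rewrite ?divr_gt0//.
by rewrite -mulrDl divff// gt_eqF.
Qed.

End hoelder_ereal.

Section completion.
Context {R : realType} {n : nat}.
Local Open Scope ereal_scope.

Lemma sub_lebesgue_measurable (A : set 'rV[R]_n) : measurable A ->
  measurable (A : set (lebesgue_type R n)).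
Proof. by move=> mA; apply: sub_caratheodory; exact: sub_sigma_algebra. Qed.

Lemma measurable_lebesgue_id :
  measurable_fun setT (id : lebesgue_type R n -> 'rV[R]_n).
Proof. by move=> _ A mA; rewrite setTI; exact: sub_lebesgue_measurable. Qed.

Lemma integral_completed (f : 'rV[R]_n -> \bar R) :
  measurable_fun setT f -> (forall x, 0 <= f x) ->
  \int[completed_lebesgue_rV R n]_x f x = \int[lebesgue_rV R n]_x f x.
Proof.
move=> mf f0.
pose pm : {measure set 'rV[R]_n -> \bar R} :=
  measure_function_pushforward__canonical__measure_function_Measure
    (completed_lebesgue_rV R n) measurable_lebesgue_id.
rewrite [RHS](@eq_measure_integral _ _ _ setT pm).
  apply/esym; apply: (@ge0_integral_pushforward _ _ _ _ _ _
    measurable_lebesgue_id (completed_lebesgue_rV R n) setT f measurableT mf).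
  by move=> x _.
move=> A mA _; rewrite /pm /= /pushforward preimage_id.
by rewrite /completed_measure_extension /= measurable_mu_extE.
Qed.

Lemma completed_sigma_finite : sigma_finite setT (completed_lebesgue_rV R n).
Proof.
apply: completed_measure_extension_sigma_finite; exact: sigma_finiteT.
Qed.

End completion.

(** * The Bessel kernel *)

Section gamma_integral.
Context {R : realType}.
Local Notation mu := (@lebesgue_measure R).

Lemma powR_le_expR (m b x : R) : 0 < m -> 0 < b -> 0 <= x ->
  x `^ m <= (m / b) `^ m * expR (b * x).
Proof.
move=> m0 b0 x0; have mb : 0 < m / b by rewrite divr_gt0.
have -> : x `^ m = (m / b) `^ m * (b * x / m) `^ m.
  rewrite -powRM ?(divr_ge0 (mulr_ge0 (ltW b0) x0) (ltW m0)) ?(ltW mb)//.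
  congr (_ `^ m).
  by field; rewrite (gt_eqF m0) (gt_eqF b0).
apply: ler_wpM2l; first exact: powR_ge0.
have -> : expR (b * x) = expR (b * x / m) `^ m.
  by rewrite -expRM divfK ?(gt_eqF m0).
rewrite ge0_ler_powR ?nnegrE ?(ltW m0) ?expR_ge0//.
  exact: divr_ge0 (mulr_ge0 (ltW b0) x0) (ltW m0).
by apply: le_trans (expR_ge1Dx _); rewrite lerDr.
Qed.

(* The derivative of [x `^ k / (1 + x `^ k)], a bounded function. *)
Let phi (k x : R) := k * x `^ (k - 1) / (1 + x `^ k) ^+ 2.
Let Phi (k x : R) := 1 - (1 + x `^ k)^-1.

Let den_gt0 (k x : R) : 0 < 1 + x `^ k.
Proof. by rewrite ltr_pwDl// powR_ge0. Qed.

Let derivable_powRx (k x : R) : 0 < x -> derivable (@powR R ^~ k) x 1.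
Proof. by move=> x0; apply: derivable_powR; rewrite in_itv/= x0. Qed.

Let derivable_den (k x : R) : 0 < x -> derivable (fun x : R => 1 + x `^ k) x 1.
Proof. by move=> x0; apply: derivableD => //; exact: derivable_powRx. Qed.

Let derivable_Phi k x : 0 < x -> derivable (Phi k) x 1.
Proof.
move=> x0; apply: derivableB => //; apply: derivableV.
  by rewrite gt_eqF.
exact: derivable_den.
Qed.

Let derivable_phi k x : 0 < x -> derivable (phi k) x 1.
Proof.
move=> x0; apply: derivableM; first exact/derivableM/derivable_powRx.
apply: derivableV; first by rewrite expf_neq0// gt_eqF.
apply: (@derivableX _ _ (fun x => 1 + x `^ k) 2); exact: derivable_den.
Qed.

Let derive_Phi k x : 0 < x -> derive1 (Phi k) x = phi k x.
Proof.
move=> x0; rewrite derive1E /Phi deriveB//; last first.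
  by apply: derivableV; [rewrite gt_eqF|exact: derivable_den].
rewrite derive_cst deriveV ?gt_eqF//; last exact: derivable_den.
rewrite deriveD//; last exact: derivable_powRx.
rewrite derive_cst -derive1E powR_derive1 ?in_itv/= ?x0//.
by rewrite !add0r /phi -[_ *: _]/(_ * _) mulNr opprK mulrC.
Qed.

Let integral_phi_le (k : R) (m : nat) : 0 < k ->
  (\int[mu]_(x in `[(m.+2%:R^-1)%R, (m.+2%:R)%R]) (phi k x)%:E <= 1)%E.
Proof.
move=> k0; have m0 : 0 < m.+2%:R :> R by rewrite ltr0n.
have pos (x : R) : x \in `[m.+2%:R^-1, m.+2%:R] -> 0 < x.
  by rewrite in_itv/= => /andP[+ _]; apply: lt_le_trans; rewrite invr_gt0.
have cPhi (x : R) : 0 < x -> {for x, continuous (Phi k)}.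
  by move=> x0; apply/differentiable_continuous; rewrite -derivable1_diffP; exact: derivable_Phi.
rewrite (@continuous_FTC2 _ _ (Phi k)).
- rewrite -EFinB lee_fin /Phi.
  have : 0 <= (1 + m.+2%:R `^ k)^-1 :> R by rewrite invr_ge0 ltW.
  have : (1 + m.+2%:R^-1 `^ k)^-1 <= 1 :> R by rewrite invf_le1// lerDl powR_ge0.
  lra.
- by apply: (@lt_trans _ _ 1); rewrite ?invf_lt1 ?ltr1n.
- by apply: derivable_within_continuous => x /pos; exact: derivable_phi.
- split.
  + by move=> x /subset_itv_oo_cc/pos; exact: derivable_Phi.
  + by apply: cvg_at_right_filter; apply: cPhi; rewrite invr_gt0.
  + by apply: cvg_at_left_filter; exact: cPhi.
- by move=> x /subset_itv_oo_cc/pos; exact: derive_Phi.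
Qed.

Let bigcup_itv : \bigcup_m `[m.+2%:R^-1, m.+2%:R]%classic = `]0, +oo[%classic :> set R.
Proof.
apply/seteqP; split=> x /=.
  move=> [m _] /=; rewrite !in_itv/= andbT => /andP[+ _].
  by apply: lt_le_trans; rewrite invr_gt0 ltr0n.
rewrite in_itv/= andbT => x0; exists (maxn (Num.bound x) (Num.bound x^-1)) => //=.
have b1 (y : R) (p : nat) : 0 < y -> (Num.bound y <= p)%N -> y <= p.+2%:R.
  move=> y0 yp; apply: ltW; apply: (lt_le_trans (archi_boundP (ltW y0))).
  by rewrite ler_nat (leq_trans yp)// -addn2 leq_addr.
rewrite in_itv/= b1 ?leq_maxl// andbT -[leRHS]invrK lef_pV2 ?posrE ?invr_gt0//.
by rewrite b1 ?invr_gt0 ?leq_maxr.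
Qed.

Lemma gamma_integral_lty (k b : R) : 0 < k -> 0 < b ->
  (\int[mu]_(x in `]0%R, +oo[) (expR (- b * x) * x `^ (k - 1))%:E < +oo)%E.
Proof.
move=> k0 b0; pose A := (2 * k / b) `^ (2 * k); pose C := k^-1 * (2 + 2 * A).
have A0 : 0 <= A by exact: powR_ge0.
have A2 : 0 < 2 + 2 * A by rewrite ltr_pwDl// mulr_ge0.
have C0 : 0 <= C by rewrite mulr_ge0 ?invr_ge0// ltW.
have mpow a : measurable_fun [set: R] (fun x : R => x `^ a).
  exact: (@measurable_powR R a).
have phi0 x : 0 <= phi k x.
  by rewrite divr_ge0 ?exprn_ge0 ?mulr_ge0 ?powR_ge0 ?ltW.
have mphi : measurable_fun [set: R] (phi k).
  have -> : phi k = fun x => k * x `^ (k - 1) * ((1 + x `^ k) ^+ 2) `^ (-1).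
    by apply/funext => x; rewrite powR_inv1// sqr_ge0.
  apply: measurable_funM; first exact: measurable_funM.
  apply: (measurableT_comp (mpow _)); apply: measurable_funX.
  exact: measurable_funD.
have bnd (x : R) : 0 < x -> expR (- b * x) * x `^ (k - 1) <= C * phi k x.
  move=> x0; rewrite /C /phi mulrACA !mulrA mulVf ?gt_eqF// mul1r -!mulrA mulrC.
  rewrite ler_wpM2l ?powR_ge0// mulNr expRN -lef_pV2 ?posrE; last 2 first.
  - by rewrite divr_gt0 ?exprn_gt0.
  - by rewrite invr_gt0 expR_gt0.
  rewrite invfM !invrK mulrC ler_pdivrMr//.
  have := powR_le_expR (mulr_gt0 (ltr0Sn R 1) k0) b0 (ltW x0); rewrite -/A.
  have : 1 <= expR (b * x) by rewrite -expR0 ler_expR mulr_ge0 ?ltW.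
  rewrite (mulrC 2 k) powRrM powR_mulrn ?powR_ge0//.
  set y := x `^ k; set e := expR (b * x) => e1 yA.
  have := sqr_ge0 (y - 1); nra.
have le1 : (\int[mu]_(x in `]0%R, +oo[) (phi k x)%:E <= 1)%E.
  pose I (m : nat) : set R := `[m.+2%:R^-1, m.+2%:R]%classic.
  have cv : (\int[mu]_(x in I m) (phi k x)%:E @[m --> \oo] -->
      \int[mu]_(x in \bigcup_m I m) (phi k x)%:E)%E.
    apply: ge0_nondecreasing_set_cvg_integral => //.
    - apply/nondecreasing_seqP => m; apply/subsetPset => x; rewrite /I /=.
      rewrite !in_itv/= => /andP[mx xm]; apply/andP; split.
        by rewrite (le_trans _ mx)// lef_pV2 ?posrE ?ltr0n// ler_nat.
      by rewrite (le_trans xm)// ler_nat.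
    - by move=> m; exact: measurable_itv.
    - by move=> m; apply/measurable_EFinP; exact: measurable_funTS.
    - by move=> m x _; rewrite lee_fin.
  rewrite -bigcup_itv; apply: (cvge_le _ cv).
  by near=> m; exact: integral_phi_le.
have mE : measurable_fun [set: R] (fun x => expR (- b * x) * x `^ (k - 1)).
  apply: measurable_funM; last exact: mpow.
  apply: measurableT_comp => //; exact: mulrl_measurable.
have le2 : (\int[mu]_(x in `]0%R, +oo[) (expR (- b * x) * x `^ (k - 1))%:E <=
    \int[mu]_(x in `]0%R, +oo[) (C%:E * (phi k x)%:E))%E.
  apply: ge0_le_integral => //.
  - by move=> x _; rewrite lee_fin mulr_ge0 ?expR_ge0 ?powR_ge0.
  - by apply/measurable_EFinP; exact: measurable_funTS.
  - by apply: measurable_funeM; apply/measurable_EFinP; exact: measurable_funTS.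
  - by move=> x; rewrite /= in_itv/= andbT => /bnd; rewrite -EFinM lee_fin.
apply: (le_lt_trans le2); rewrite ge0_integralZl//; last 2 first.
- by apply/measurable_EFinP; exact: measurable_funTS.
- by move=> x _; rewrite lee_fin.
apply: le_lt_trans (lee_wpmul2l _ le1) _; first by rewrite lee_fin.
by rewrite mule1 ltry.
Unshelve. all: by end_near. Qed.
End gamma_integral.

Section ge0_integral_le.
Context {d} {T : measurableType d} {R : realType}.
Variable mu : {measure set T -> \bar R}.
Local Open Scope ereal_scope.

Lemma ge0_integral_le_ae_eq (f g : T -> \bar R) :
  measurable_fun setT f -> measurable_fun setT g -> (forall x, 0 <= f x) ->
  (forall x, f x <= g x) -> \int[mu]_x f x < +oo ->
  \int[mu]_x g x <= \int[mu]_x f x -> {ae mu, forall x, f x = g x}.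
Proof.
move=> mf mg f0 fg Ify gf.
have g0 x : 0 <= g x by exact: le_trans (fg x).
pose h x := maxe 0 (g x - f x).
have mh : measurable_fun setT h by apply: measurable_maxe => //; exact: emeasurable_funB.
have h0 x : 0 <= h x by rewrite le_max lexx.
have fhg x : f x + h x = g x.
  rewrite /h; move: (fg x) (f0 x) (g0 x).
  case: (f x) (g x) => [r| |] [s| |]//; rewrite ?lee_fin => rs r0 s0.
  - by rewrite -EFinB -EFin_max -EFinD max_r ?subr_ge0// addrC subrK.
  - by rewrite /= max_r ?leey.
have Ih : \int[mu]_x f x + \int[mu]_x h x = \int[mu]_x f x.
  apply/eqP; rewrite eq_le; apply/andP; split; last by rewrite leeDl ?integral_ge0.
  by rewrite -ge0_integralD//; under eq_integral do rewrite fhg.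
have {}Ih : \int[mu]_x h x = 0.
  move: Ih Ify; have : 0 <= \int[mu]_x f x by exact: integral_ge0.
  have : 0 <= \int[mu]_x h x by exact: integral_ge0.
  case: (\int[mu]_x f x) (\int[mu]_x h x) => [r| |] [s| |]//= _ _ + _.
  by rewrite -EFinD => -[] /(canRL (addKr _)); rewrite addNr => ->.
apply: filterS (ge0_integral_eq0_ae mh h0 Ih) => x hx.
by rewrite -(fhg x) hx adde0.
Qed.

End ge0_integral_le.

Section bessel.
Context {R : realType} {n : nat} (alpha : R).
Local Open Scope ereal_scope.
Notation mu := (@lebesgue_measure R).
Notation weight_exp := ((- n%:R + alpha) / 2)%R.

Definition bweight (t : R) : R :=
  (\1_`]0%R, +oo[ t * (expR (- (4 * pi)^-1 * t) * t `^ (weight_exp - 1)))%R.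

Definition bheat (r t : R) : R := expR (- (pi * t `^ (-1)) * r).

(* The Bessel kernel as a function of [r = |x|^2], without its normalization. *)
Definition bprofile (r : R) : \bar R := \int[mu]_t (bheat r t * bweight t)%:E.

Lemma bweight_gt0 t : (0 < t)%R -> (0 < bweight t)%R.
Proof.
move=> t0; rewrite /bweight indicE mem_set; last by rewrite /= in_itv/= t0.
by rewrite mul1r mulr_gt0 ?expR_gt0 ?powR_gt0.
Qed.

Lemma bweight_eq0 t : (t <= 0)%R -> bweight t = 0%R.
Proof.
move=> t0; rewrite /bweight indicE memNset ?mul0r//=.
by rewrite in_itv/= andbT => /lt_le_trans/(_ t0); rewrite ltxx.
Qed.

Lemma bweight_ge0 t : (0 <= bweight t)%R.
Proof.
have [/bweight_eq0->//|/bweight_gt0/ltW//] := leP t 0%R.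
Qed.

Lemma bheat_gt0 r t : (0 < bheat r t)%R. Proof. exact: expR_gt0. Qed.

Lemma bheat_weight_ge0 r t : 0 <= (bheat r t * bweight t)%:E.
Proof. by rewrite lee_fin mulr_ge0 ?bweight_ge0// ltW// bheat_gt0. Qed.

Lemma bessel_kernelE (x : 'rV[R]_n) :
  bessel_kernel alpha x = (bessel_gamma alpha)^-1%:E * bprofile (sqn x).
Proof.
congr (_ * _); rewrite integral_mkcond /bprofile; apply: eq_integral => t _.
rewrite patchE; case: ifPn => [|tn]; last first.
  rewrite bweight_eq0 ?mulr0// leNgt; apply: contra tn => t0.
  by rewrite inE/= in_itv/= t0.
rewrite inE/= in_itv/= andbT => t0; congr EFin.
rewrite /bweight indicE mem_set; last by rewrite /= in_itv/= t0.
rewrite mul1r /bheat powR_inv1 ?ltW//.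
rewrite powRB ?(gt_eqF t0)//; last by rewrite implybT.
rewrite powRr1 ?ltW// sqr_enorm !mulrA; congr (expR _ * expR _ * _ / _)%R.
  by rewrite mulrAC mulNr.
by rewrite mulrC mulNr mulrN.
Qed.

Lemma measurable_bweight : measurable_fun setT bweight.
Proof.
apply: measurable_funM; first exact: measurable_indic.
apply: measurable_funM; last exact: measurable_powR.
by apply: measurableT_comp => //; exact: mulrl_measurable.
Qed.

Lemma measurable_bheat d (T : measurableType d) (r t : T -> R) :
  measurable_fun setT r -> measurable_fun setT t ->
  measurable_fun setT (fun x => bheat (r x) (t x)).
Proof.
move=> mr mt; apply: measurableT_comp => //; apply: measurable_funM => //.
apply: measurableT_comp => //; apply: measurable_funM => //.
by apply: (measurableT_comp (@measurable_powR R (-1))).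
Qed.

Lemma measurable_bheat_weight d (T : measurableType d) (r t : T -> R) :
  measurable_fun setT r -> measurable_fun setT t ->
  measurable_fun setT (fun x => (bheat (r x) (t x) * bweight (t x))%:E).
Proof.
move=> mr mt; apply/measurable_EFinP; apply: measurable_funM.
  exact: measurable_bheat.
exact: (measurableT_comp measurable_bweight).
Qed.

Lemma bprofile_ge0 r : 0 <= bprofile r.
Proof. by apply: integral_ge0 => t _; exact: bheat_weight_ge0. Qed.

Lemma measurable_bprofile : measurable_fun [set: R] bprofile.
Proof.
pose f (p : measurableTypeR R * measurableTypeR R) := (bheat p.1 p.2 * bweight p.2)%:E.
have mf : measurable_fun setT f by exact: measurable_bheat_weight.
have f0 p : 0 <= f p by exact: bheat_weight_ge0.
exact: (@measurable_fun_fubini_tonelli_F _ _ _ _ _ mu f mf f0).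
Qed.

Lemma ler_bheat r s t : (r <= s)%R -> (bheat s t <= bheat r t)%R.
Proof.
move=> rs; rewrite ler_expR !mulNr lerN2 ler_wpM2l// mulr_ge0 ?powR_ge0//.
exact/ltW/pi_gt0.
Qed.

Lemma ltr_bheat r s t : (r < s)%R -> (0 < t)%R -> (bheat s t < bheat r t)%R.
Proof.
by move=> rs t0; rewrite ltr_expR !mulNr ltrN2 ltr_pM2l// mulr_gt0 ?pi_gt0 ?powR_gt0.
Qed.

Lemma le_bprofile r s : (r <= s)%R -> bprofile s <= bprofile r.
Proof.
move=> rs; apply: ge0_le_integral => //.
- by move=> t _; exact: bheat_weight_ge0.
- exact: measurable_bheat_weight.
- exact: measurable_bheat_weight.
- by move=> t _; rewrite lee_fin ler_wpM2r ?bweight_ge0// ler_bheat.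
Qed.

Lemma lt_bprofile r s : (r < s)%R -> bprofile r < +oo -> bprofile s < bprofile r.
Proof.
move=> rs ry; rewrite ltNge; apply/negP => rs'.
have sy : bprofile s < +oo by apply: le_lt_trans ry; exact/le_bprofile/ltW.
have [N [mN N0 sN]] : {ae mu, forall t,
    (bheat s t * bweight t)%:E = (bheat r t * bweight t)%:E}.
  apply: (ge0_integral_le_ae_eq _ _ _ _ sy rs').
  - exact: measurable_bheat_weight.
  - exact: measurable_bheat_weight.
  - by move=> t; exact: bheat_weight_ge0.
  - by move=> t; rewrite lee_fin ler_wpM2r ?bweight_ge0// ler_bheat// ltW.
have : mu `]0%R, 1%R] <= mu N.
  apply: le_measure; rewrite ?inE// => t; rewrite /= in_itv/= => /andP[t0 _].
  apply: sN => /= -[] /(mulIf _) h.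
  have := ltr_bheat rs t0; rewrite h ?ltxx//.
  by rewrite gt_eqF// bweight_gt0.
by rewrite N0 lebesgue_measure_itv/= lte_fin ltr01 -EFinB subr0 lee_fin ler10.
Qed.

Lemma bprofile_lsc (a : R) (r_ : R^nat) (r : R) : (0 <= a)%R -> r_ @ \oo --> r ->
  a%:E * bprofile r <= limn_einf (fun k => a%:E * bprofile (r_ k)).
Proof.
move=> a0 rr.
have m k : measurable_fun setT (fun t => a%:E * (bheat k t * bweight t)%:E).
  by apply: measurable_funeM; exact: measurable_bheat_weight.
have p0 k t : 0 <= a%:E * (bheat k t * bweight t)%:E.
  by rewrite mule_ge0 ?bheat_weight_ge0.
have E k : a%:E * bprofile k = \int[mu]_t (a%:E * (bheat k t * bweight t)%:E).
  rewrite ge0_integralZl//; first exact: measurable_bheat_weight.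
  by move=> t _; exact: bheat_weight_ge0.
rewrite E (_ : (fun k => _) = fun k =>
  \int[mu]_t (a%:E * (bheat (r_ k) t * bweight t)%:E)); last exact/funext.
apply: le_trans (fatou mu measurableT (fun k => m (r_ k)) (fun k t _ => p0 (r_ k) t)).
rewrite le_eqVlt; apply/orP; left; apply/eqP; apply: eq_integral => t _.
apply/esym; apply: (cvg_limn_einf_sup _).1.
under eq_fun do rewrite -EFinM; rewrite -EFinM.
apply: cvg_EFin; first by near=> k.
apply: cvgM; first exact: cvg_cst.
apply: cvgM; last exact: cvg_cst.
apply: (cvg_comp _ expR); last exact: continuous_expR.
by apply: cvgM => //; exact: cvg_cst.
Unshelve. all: by end_near. Qed.

Lemma integral_bprofile_lty (s : R) : (1 < s)%R ->
  (0 < n%:R / (2 * s) + weight_exp)%R ->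
  \int[lebesgue_rV R n]_x (bprofile (sqn x)) `^ s < +oo.
Proof.
move=> s1 k0; have s0 : (0 < s)%R by exact: lt_trans s1.
pose a : R := (n%:R / (2 * s))%R.
have as2 : (a * s = n%:R / 2)%R by rewrite /a; field; rewrite gt_eqF.
have sV0 : (0 < s^-1)%R by rewrite invr_gt0.
have sV1 : (0 < 1 - s^-1)%R by rewrite subr_gt0 invf_lt1.
pose h t := (t `^ a * bweight t)%:E.
pose f (x : 'rV[R]_n) t :=
  (expR (- (s * (pi * t `^ (-1))) * sqn x) * (t `^ (a * (1 - s)) * bweight t))%:E.
have h0 t : 0 <= h t by rewrite lee_fin mulr_ge0 ?powR_ge0 ?bweight_ge0.
have f0 x t : 0 <= f x t.
  by rewrite lee_fin !mulr_ge0 ?expR_ge0 ?powR_ge0 ?bweight_ge0.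
have mpow b : measurable_fun [set: R] (fun t : R => (t `^ b)%R).
  exact: (@measurable_powR R b).
have mh : measurable_fun setT h.
  apply/measurable_EFinP; apply: measurable_funM => //.
  exact: measurable_bweight.
have mf : measurable_fun setT (fun p : 'rV[R]_n * measurableTypeR R => f p.1 p.2).
  apply/measurable_EFinP; apply: measurable_funM; last first.
    apply: (@measurableT_comp _ _ _ _ _ _ (fun t => t `^ (a * (1 - s)) * bweight t)%R) => //.
    by apply: measurable_funM => //; exact: measurable_bweight.
  apply: measurableT_comp => //; apply: measurable_funM; last exact: measurable_sqn.
  apply: measurableT_comp => //; apply: measurable_funM => //.
  apply: measurable_funM => //; exact: (measurableT_comp (mpow (-1)%R)).
have My : \int[mu]_t h t < +oo.
  have b0 : (0 < (4 * pi)^-1 :> R)%R by rewrite invr_gt0 mulr_gt0// pi_gt0.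
  have := gamma_integral_lty k0 b0; rewrite integral_mkcond.
  congr (_ < _); apply: eq_integral => t _; rewrite patchE.
  case: ifPn => [|tn]; last first.
    rewrite /h bweight_eq0 ?mulr0// leNgt; apply: contra tn => t0.
    by rewrite inE/= in_itv/= t0.
  rewrite inE/= in_itv/= andbT => t0; rewrite /h /bweight indicE mem_set; last first.
    by rewrite /= in_itv/= t0.
  rewrite mul1r mulrCA -powRD; last by rewrite (gt_eqF t0) implybT.
  by rewrite addrA.
have bE x t : (bheat (sqn x) t * bweight t)%:E = f x t `^ s^-1 * h t `^ (1 - s^-1).
  rewrite /f /h !poweR_EFin -EFinM; congr EFin.
  have [t0|t0] := leP t 0%R.
    by rewrite bweight_eq0// !mulr0 !powR0 ?mulr0// gt_eqF.
  move: (bweight t) (bweight_gt0 t0) => w w0.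
  rewrite !powRM ?mulr_ge0 ?expR_ge0 ?powR_ge0 ?(ltW w0)//.
  rewrite -expRM -!powRrM.
  rewrite [RHS](_ : _ = expR (- (s * (pi * t `^ (-1))) * sqn x * s^-1) *
    (t `^ (a * (1 - s) * s^-1) * t `^ (a * (1 - s^-1))) *
    (w `^ s^-1 * w `^ (1 - s^-1)))%R; last by ring.
  rewrite -!powRD ?(gt_eqF t0) ?(gt_eqF w0) ?implybT//.
  rewrite (_ : s^-1 + _ = 1)%R; last by rewrite addrC subrK.
  rewrite (_ : a * (1 - s) * s^-1 + _ = 0)%R; last by field; rewrite gt_eqF.
  rewrite powRr0 powRr1 ?(ltW w0)// mulr1; congr (expR _ * _)%R.
  by field; rewrite gt_eqF.
pose M := \int[mu]_t h t.
have M0 : 0 <= M by exact: integral_ge0.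
have mfx x : measurable_fun setT (f x).
  exact: (measurableT_comp mf (measurable_pair1 x)).
have le1 x : bprofile (sqn x) `^ s <= (\int[mu]_t f x t) * M `^ (s - 1).
  rewrite (_ : _ * _ = ((\int[mu]_t f x t) `^ s^-1 * M `^ (1 - s^-1)) `^ s).
    apply: gt0_ler_poweR; rewrite ?in_itv/= ?leey ?andbT.
    - exact: ltW.
    - exact: bprofile_ge0.
    - by rewrite mule_ge0 ?poweR_ge0.
    rewrite /bprofile; under eq_integral do rewrite bE.
    apply: (@hoelder_poweR _ _ _ mu _ _ _ _ sV0 sV1 _ (mfx x) mh (f0 x) h0).
    by rewrite addrC subrK.
  rewrite poweRM ?poweR_ge0// -!poweRrM mulVf ?gt_eqF// poweRe1 ?integral_ge0//.
  by rewrite mulrBl mul1r mulVf ?gt_eqF.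
pose C : R := (Num.sqrt s^-1 ^+ n)%R.
have C0 : (0 <= C)%R by rewrite exprn_ge0.
have fubE t : \int[lebesgue_rV R n]_x f x t = C%:E * h t.
  rewrite /f /h; have [t0|t0] := leP t 0%R.
    under eq_integral do rewrite bweight_eq0// !mulr0.
    by rewrite integral0 bweight_eq0// !mulr0 mule0.
  under eq_integral do rewrite EFinM.
  rewrite ge0_integralZr//; last 2 first.
  - exact: measurable_gauss.
  - by rewrite lee_fin mulr_ge0 ?powR_ge0 ?bweight_ge0.
  rewrite integral_gauss; last by rewrite !mulr_gt0 ?pi_gt0 ?powR_gt0.
  rewrite -!EFinM; congr EFin; move: (bweight t) => w.
  rewrite !mulrA; congr (_ * _)%R.
  rewrite (_ : pi / _ = s^-1 * t)%R; last first.
    rewrite powR_inv1 ?ltW//; have := pi_gt0 R; move: (pi : R) => p p0; field.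
    by rewrite (gt_eqF t0) (gt_eqF s0) (gt_eqF p0).
  rewrite sqrtrM ?invr_ge0 ?ltW// exprMn -mulrA; congr (_ * _)%R.
  rewrite -(powR12_sqrt (ltW t0)). rewrite -powR_mulrn ?powR_ge0// -powRrM -powRD; last first.
    by rewrite (gt_eqF t0) implybT.
  by congr (_ `^ _)%R; rewrite mulrBr mulr1 as2; field.
have mp : measurable_fun setT (fun x : 'rV[R]_n => bprofile (sqn x) `^ s).
  apply: measurable_fun_poweR; apply: (measurableT_comp measurable_bprofile).
  exact: measurable_sqn.
have Mf : M \is a fin_num by rewrite ge0_fin_numE.
have le2 : \int[lebesgue_rV R n]_x (bprofile (sqn x)) `^ s <=
    \int[lebesgue_rV R n]_x ((\int[mu]_t f x t) * M `^ (s - 1)).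
  have ifx x : 0 <= \int[mu]_t f x t by exact: integral_ge0.
  apply: ge0_le_integral => //.
    by move=> x _; exact: poweR_ge0.
  apply: emeasurable_funM => //.
  exact: (@measurable_fun_fubini_tonelli_F _ _ _ _ _ mu _ mf (fun p => f0 p.1 p.2)).
apply: (le_lt_trans le2); rewrite ge0_integralZr//; last 3 first.
- exact: (@measurable_fun_fubini_tonelli_F _ _ _ _ _ mu _ mf (fun p => f0 p.1 p.2)).
- by move=> x _; exact: integral_ge0.
- exact: poweR_ge0.
rewrite (fubini_tonelli _ mf (fun p => f0 p.1 p.2))/=.
under eq_integral do rewrite fubE.
rewrite ge0_integralZl// -/M -[M]fineK// poweR_EFin -!EFinM.
by rewrite ltry.
Qed.

End bessel.

(** * Moving planes *)

Section inequalities.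
Context {R : realType}.

Lemma powR_sub_le (b x y : R) : 1 < b -> 0 < y -> y <= x ->
  x `^ b - y `^ b <= b * x `^ (b - 1) * (x - y).
Proof.
move=> b1 y0 yx; have b0 : 0 < b by exact: lt_trans b1.
have x0 : 0 < x by exact: lt_le_trans yx.
have bB : 0 < b - 1 by rewrite subr_gt0.
have cq : b^-1 + (b / (b - 1))^-1 = 1.
  by field; rewrite (gt_eqF b0) (gt_eqF bB).
have bq : (b - 1) * (b / (b - 1)) = b by field; rewrite (gt_eqF bB).
have := conjugate_powR (ltW y0) (powR_ge0 x (b - 1)) b0 (divr_gt0 b0 bB) cq.
rewrite -powRrM bq -(@mulr_powRB1 _ x b) ?(ltW x0)//.
move: (x `^ _) (y `^ _) => X Y h.
have : b * (y * X) <= Y + (b - 1) * (x * X).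
  rewrite (_ : Y + _ = b * (Y / b + x * X / (b / (b - 1)))).
    by rewrite ler_wpM2l// ltW.
  by field; rewrite (gt_eqF b0) (gt_eqF bB).
lra.
Qed.

Lemma lee_rearrange (a b : \bar R) (x y : R) : (0 <= b)%E -> (b <= a)%E ->
  0 < x -> x <= y -> (a * x%:E + b * y%:E <= b * x%:E + a * y%:E)%E.
Proof.
move=> b0 ba x0 xy; have y0 : 0 < y by exact: lt_le_trans xy.
case: a b b0 ba => [a| |] [b| |]//; rewrite ?lee_fin => b0 ba.
- nra.
- by rewrite [X in (_ <= _ + X)%E]gt0_mulye ?lte_fin// -EFinM addey ?leey.
Qed.

End inequalities.

Lemma limn_einf_gt_near {R : realType} (v : (\bar R)^nat) (c : \bar R) :
  (c < limn_einf v)%E -> \forall k \near \oo, (c < v k)%E.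
Proof.
rewrite limn_einf_lim (cvg_lim _ (@cvg_einfs_sup _ v))// => /ereal_sup_gt[_ [N _ <-] cN].
exists N => // k /= Nk; apply: (lt_le_trans cN); apply: ereal_inf_lbound.
by exists k.
Qed.

Lemma cvge0_lt_near {R : realType} (v : (\bar R)^nat) (eps : R) :
  0 < eps -> (v @ \oo --> 0)%E -> \forall k \near \oo, (v k < eps%:E)%E.
Proof.
move=> eps0 v0; apply: (v0 [set y | (y < eps%:E)%E]).
by apply: open_nbhs_nbhs; split; [exact: open_ereal_lt_ereal|rewrite /= lte_fin].
Qed.

Section integral_equation.
Context {R : realType} {n : nat}.
Notation mu := (lebesgue_rV R n).
Local Open Scope ereal_scope.
Variables (K : R -> \bar R) (beta q : R) (u : 'rV[R]_n -> R).
Hypothesis K_ge0 : forall r, 0 <= K r.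
Hypothesis mK : measurable_fun [set: R] K.
Hypothesis K_le : forall r s, (r <= s)%R -> K s <= K r.
Hypothesis K_lt : forall r s, (r < s)%R -> K r < +oo -> K s < K r.
Hypothesis K_lsc : forall (a : R) (r_ : R^nat) (r : R), (0 <= a)%R ->
  r_ @ \oo --> r -> a%:E * K r <= limn_einf (fun k => a%:E * K (r_ k)).
Hypothesis beta1 : (1 < beta)%R.
Hypothesis qbeta : (beta < q)%R.
Hypothesis K_lty : \int[mu]_x K (sqn x) `^ (q / (q - beta + 1)) < +oo.
Hypothesis mu_u : measurable_fun setT u.
Hypothesis u_gt0 : forall x, (0 < u x)%R.
Hypothesis u_eq : forall x,
  (u x)%:E = \int[mu]_y (K (sqn (x - y)) * (u y `^ beta)%:E).
Hypothesis u_lty : \int[mu]_x (u x `^ q)%:E < +oo.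

Implicit Types (e x y : 'rV[R]_n) (l : R).

Let beta0 : (0 < beta)%R. Proof. exact: lt_trans beta1. Qed.
Let q0 : (0 < q)%R. Proof. exact: lt_trans qbeta. Qed.

Let mKsub x : measurable_fun setT (fun y => K (sqn (x - y))).
Proof.
by apply: (measurableT_comp mK); apply: measurable_sqn; exact: measurable_subv.
Qed.

Let mKsub2 :
  measurable_fun setT (fun p : 'rV[R]_n * 'rV[R]_n => K (sqn (p.1 - p.2))).
Proof.
by apply: (measurableT_comp mK); apply: measurable_sqn; exact: measurable_subv.
Qed.

Let mrefl e l : measurable_fun setT (refl e l : 'rV[R]_n -> 'rV[R]_n).
Proof. exact: measurable_refl. Qed.

Let mpowu b : measurable_fun setT (fun x => (u x `^ b)%R).
Proof. exact: (measurableT_comp (@measurable_powR R b)). Qed.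

Lemma integral_fold e l (f : 'rV[R]_n -> \bar R) : sqn e = 1%R ->
  measurable_fun setT f -> (forall x, 0 <= f x) ->
  \int[mu]_x (f x + f (refl e l x)) = \int[mu]_x f x + \int[mu]_x f x.
Proof.
move=> e1 mf f0; rewrite ge0_integralD//; last exact: (measurableT_comp mf).
by rewrite integral_refl.
Qed.

Definition excess e l : set 'rV[R]_n :=
  [set x | (l < dotv x e)%R /\ (u (refl e l x) < u x)%R].

Definition gap e l x : R := (\1_(excess e l) x * (u x - u (refl e l x)))%R.

Lemma measurable_excess e l : measurable (excess e l).
Proof.
have m1 : measurable_fun setT (fun x => l < dotv x e)%R.
  by apply: measurable_fun_ltr => //; exact: measurable_dotv.
have m2 : measurable_fun setT (fun x => u (refl e l x) < u x)%R.
  by apply: measurable_fun_ltr => //; exact: (measurableT_comp mu_u).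
rewrite (_ : excess e l = [set x | (l < dotv x e)%R] `&` [set x | (u (refl e l x) < u x)%R])//.
apply: measurableI.
  by have := m1 measurableT [set true] I; rewrite setTI.
by have := m2 measurableT [set true] I; rewrite setTI.
Qed.

Lemma gap_ge0 e l x : (0 <= gap e l x)%R.
Proof.
rewrite /gap indicE; have [/set_mem[_ h]|_] := boolP (x \in excess e l).
  by rewrite mul1r subr_ge0 ltW.
by rewrite mul0r.
Qed.

Lemma gap_out e l x : ~ excess e l x -> gap e l x = 0%R.
Proof. by move=> h; rewrite /gap indicE memNset// mul0r. Qed.

Lemma gap_in e l x : excess e l x -> gap e l x = (u x - u (refl e l x))%R.
Proof. by move=> h; rewrite /gap indicE mem_set// mul1r. Qed.

Lemma gap_le e l x : (gap e l x <= u x)%R.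
Proof.
have [h|h] := pselect (excess e l x); last by rewrite gap_out// ltW.
by rewrite gap_in// lerBlDr lerDl ltW.
Qed.

Lemma measurable_gap e l : measurable_fun setT (gap e l).
Proof.
apply: measurable_funM; first by apply: measurable_indic; exact: measurable_excess.
by apply: measurable_funB => //; exact: (measurableT_comp mu_u).
Qed.

Lemma refl_fix e l x : dotv x e = l -> refl e l x = x.
Proof. by move=> h; rewrite /refl h subrr mulr0 scale0r addr0. Qed.

Lemma K_refl e l x y : sqn e = 1%R -> (l <= dotv x e)%R -> (l <= dotv y e)%R ->
  K (sqn (x - refl e l y)) <= K (sqn (x - y)).
Proof.
move=> e1 xl yl; apply: K_le; rewrite sqn_sub_refl// lerDl.
by rewrite !mulr_ge0// subr_ge0.
Qed.

Let bgap e l y : R := (beta * u y `^ (beta - 1) * gap e l y)%R.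

Let bgap_ge0 e l y : (0 <= bgap e l y)%R.
Proof.
apply: mulr_ge0; last exact: gap_ge0.
by apply: mulr_ge0; [exact: ltW|exact: powR_ge0].
Qed.

Let mbgap e l : measurable_fun setT (bgap e l).
Proof.
apply: measurable_funM; last exact: measurable_gap.
exact: measurable_funM.
Qed.

Let le_upow x y : (u x <= u y)%R -> (u x `^ beta <= u y `^ beta)%R.
Proof. by move=> h; apply: (ge0_ler_powR (ltW beta0)) => //; rewrite nnegrE ltW. Qed.

Let fold_le e l x y : sqn e = 1%R -> (l < dotv x e)%R -> (l <= dotv y e)%R ->
  K (sqn (x - y)) * (u y `^ beta)%:E +
  K (sqn (x - refl e l y)) * (u (refl e l y) `^ beta)%:E <=
  K (sqn (x - refl e l y)) * (u y `^ beta)%:E +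
  K (sqn (x - y)) * (u (refl e l y) `^ beta)%:E +
  (K (sqn (x - y)) * (bgap e l y)%:E +
   K (sqn (x - refl e l y)) * (bgap e l (refl e l y))%:E).
Proof.
move=> e1 xl yl; have ba := K_refl e1 (ltW xl) yl.
have aK := K_ge0 (sqn (x - y)); have bK := K_ge0 (sqn (x - refl e l y)).
have posE k z : 0 <= k -> 0 <= k * (bgap e l z)%:E.
  by move=> k0; rewrite mule_ge0// lee_fin.
have [yl'|yl'] := eqVneq (dotv y e) l.
  by rewrite refl_fix// leeDl// adde_ge0// posE.
have {}yl : (l < dotv y e)%R by rewrite lt_neqAle eq_sym yl'.
have [uy|uy] := leP (u y) (u (refl e l y)).
  apply: (@le_trans _ _ (K (sqn (x - refl e l y)) * (u y `^ beta)%:E +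
      K (sqn (x - y)) * (u (refl e l y) `^ beta)%:E)).
    apply: lee_rearrange => //; first by rewrite powR_gt0.
    exact: le_upow.
  by rewrite leeDl// adde_ge0// posE.
have UV : (u (refl e l y) `^ beta <= u y `^ beta)%R.
  exact/le_upow/ltW.
have hU : (u y `^ beta <= u (refl e l y) `^ beta + bgap e l y)%R.
  rewrite /bgap gap_in// -lerBlDl.
  exact: (powR_sub_le beta1 (u_gt0 _) (ltW uy)).
set a := K _ in aK ba *; set b := K _ in bK ba *.
have h1 : b * (u (refl e l y) `^ beta)%:E <= b * (u y `^ beta)%:E.
  by apply: lee_wpmul2l.
have h2 : a * (u y `^ beta)%:E <=
    a * (u (refl e l y) `^ beta)%:E + a * (bgap e l y)%:E.
  rewrite -ge0_muleDr ?lee_fin ?powR_ge0//.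
  by apply: lee_wpmul2l => //; rewrite -EFinD lee_fin.
apply: (le_trans (leeD h2 h1)); rewrite [leLHS]addeC !addeA leeDl// posE//.
Qed.

Let fold_le_all e l x y : sqn e = 1%R -> (l < dotv x e)%R ->
  K (sqn (x - y)) * (u y `^ beta)%:E +
  K (sqn (x - refl e l y)) * (u (refl e l y) `^ beta)%:E <=
  K (sqn (x - refl e l y)) * (u y `^ beta)%:E +
  K (sqn (x - y)) * (u (refl e l y) `^ beta)%:E +
  (K (sqn (x - y)) * (bgap e l y)%:E +
   K (sqn (x - refl e l y)) * (bgap e l (refl e l y))%:E).
Proof.
move=> e1 xl; have [yl|yl] := leP l (dotv y e); first exact: fold_le.
have := @fold_le e l x (refl e l y) e1 xl _; rewrite reflK// dotv_refl//.
rewrite addeC [X in _ <= X + _]addeC [X in _ <= _ + X]addeC; apply.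
by lra.
Qed.

Let sub_refl e l x y : sqn e = 1%R ->
  K (sqn (refl e l x - y)) = K (sqn (x - refl e l y)).
Proof. by move=> e1; rewrite -[in RHS](refl_sub l _ _ e1) reflK. Qed.

Lemma half_space_le e l x : sqn e = 1%R -> (l < dotv x e)%R ->
  (u x)%:E <= (u (refl e l x))%:E + \int[mu]_y (K (sqn (x - y)) *
    (beta * u y `^ (beta - 1) * gap e l y)%:E).
Proof.
move=> e1 xl; set J := \int[mu]_y _.
pose f z y := K (sqn (z - y)) * (u y `^ beta)%:E.
pose k y := K (sqn (x - y)) * (bgap e l y)%:E.
have f0 z y : 0 <= f z y by rewrite mule_ge0// lee_fin powR_ge0.
have k0 y : 0 <= k y by rewrite mule_ge0// lee_fin.
have mf z : measurable_fun setT (f z).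
  by apply: emeasurable_funM => //; exact/measurable_EFinP.
have mk : measurable_fun setT k.
  by apply: emeasurable_funM => //; exact/measurable_EFinP.
have mfT z : measurable_fun setT (fun y => f z (refl e l y)).
  exact: (measurableT_comp (mf z)).
have mkT : measurable_fun setT (fun y => k (refl e l y)).
  exact: (measurableT_comp mk).
have fE z : \int[mu]_y (f z y + f z (refl e l y)) = (u z)%:E + (u z)%:E.
  by rewrite (integral_fold l e1 (mf z) (f0 z)) -u_eq.
have mff z : measurable_fun setT (fun y => f z y + f z (refl e l y)).
  by apply: emeasurable_funD; [exact: mf|exact: mfT].
have mkk : measurable_fun setT (fun y => k y + k (refl e l y)).
  by apply: emeasurable_funD; [exact: mk|exact: mkT].
have : (u x)%:E + (u x)%:E <= (u (refl e l x))%:E + (u (refl e l x))%:E + (J + J).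
  rewrite -!fE -(integral_fold l e1 mk k0) -ge0_integralD//; last 2 first.
  - by move=> y _; rewrite adde_ge0//; exact: f0.
  - by move=> y _; rewrite adde_ge0//; exact: k0.
  apply: ge0_le_integral => //.
  - by move=> y _; rewrite adde_ge0//; exact: f0.
  - exact: emeasurable_funD.
  - by move=> y _; rewrite /f /k refl_sub// sub_refl//; exact: fold_le_all.
have : 0 <= J by apply: integral_ge0 => y _; exact: k0.
case: J => [j| |]//=; rewrite ?leey ?addey ?leey//.
by rewrite -!EFinD !lee_fin => j0 h; lra.
Qed.

Lemma half_space_gap0 e l : sqn e = 1%R ->
  {ae mu, forall x, gap e l x = 0%R} ->
  forall x, (l < dotv x e)%R -> (u x <= u (refl e l x))%R.
Proof.
move=> e1 gap0 x xl; have := half_space_le e1 xl.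
rewrite (ge0_ae_eq_integral _ _ (@measurable_cst _ _ _ _ setT 0))//.
- by rewrite integral0 adde0 lee_fin.
- apply: emeasurable_funM; first exact: mKsub.
  apply/measurable_EFinP; exact: mbgap.
- by move=> y _; rewrite mule_ge0// lee_fin; exact: bgap_ge0.
- by apply: filterS gap0 => y -> _; rewrite mulr0 mule0.
Qed.

Notation s := (q / (q - beta + 1))%R.
Notation Ks := (\int[mu]_x K (sqn x) `^ s).

Let qb1 : (0 < q - beta + 1)%R.
Proof. by rewrite addr_gt0// subr_gt0. Qed.

Let mKs : measurable_fun setT (fun x => K (sqn x) `^ s).
Proof.
by apply: measurable_fun_poweR; apply: (measurableT_comp mK); exact: measurable_sqn.
Qed.

Let integral_Ks x : \int[mu]_y K (sqn (x - y)) `^ s = Ks.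
Proof.
rewrite -(integral_rV_shift (- x)%R mKs); last by move=> y; exact: poweR_ge0.
by apply: eq_integral => y _; rewrite -sqnN opprB.
Qed.

Let integral_Ks' y : \int[mu]_x K (sqn (x - y)) `^ s = Ks.
Proof. by rewrite -(integral_rV_shift (- y)%R mKs)// => x; exact: poweR_ge0. Qed.

Definition excess_mass e l := \int[mu]_y (\1_(excess e l) y * u y `^ q)%:E.

(* Hoelder's inequality with the exponents q, q / (q - beta) and q / (beta - 1). *)
Lemma young_gap e l x :
  \int[mu]_y (K (sqn (x - y)) * (u y `^ (beta - 1) * gap e l y)%:E) <=
  (\int[mu]_y (K (sqn (x - y)) `^ s * (gap e l y `^ q)%:E)) `^ q^-1 *
  (Ks `^ (1 - beta / q) * excess_mass e l `^ ((beta - 1) / q)).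
Proof.
have c0 : (0 < (beta - 1) / q)%R by rewrite divr_gt0// subr_gt0.
have b0 : (0 < 1 - beta / q)%R by rewrite subr_gt0 ltr_pdivrMr// mul1r.
have qV0 : (0 < q^-1)%R by rewrite invr_gt0.
have mF : measurable_fun setT (fun y => K (sqn (x - y)) `^ s * (gap e l y `^ q)%:E).
  apply: emeasurable_funM; first exact: measurable_fun_poweR.
  apply/measurable_EFinP; apply: (measurableT_comp (@measurable_powR R q)).
  exact: measurable_gap.
have mG : measurable_fun setT (fun y => K (sqn (x - y)) `^ s).
  exact: measurable_fun_poweR.
have mH : measurable_fun setT (fun y => (\1_(excess e l) y * u y `^ q)%:E).
  apply/measurable_EFinP; apply: measurable_funM => //.
  by apply: measurable_indic; exact: measurable_excess.
have H0 y : 0 <= (\1_(excess e l) y * u y `^ q)%:E.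
  by rewrite lee_fin mulr_ge0 ?powR_ge0.
have F0 y : 0 <= K (sqn (x - y)) `^ s * (gap e l y `^ q)%:E.
  by rewrite mule_ge0 ?poweR_ge0// lee_fin powR_ge0.
have abc : (q^-1 + (1 - beta / q) + (beta - 1) / q = 1)%R.
  by field; rewrite (gt_eqF q0).
rewrite -(integral_Ks x); apply: le_trans (@hoelder3_poweR _ _ _ mu _ _ _ _ _ _
  qV0 b0 c0 abc mF mG mH F0 (fun y => poweR_ge0 _ _) H0).
rewrite le_eqVlt; apply/orP; left; apply/eqP; apply: eq_integral => y _.
have qn0 : q != 0%R by rewrite gt_eqF.
have [yE|yE] := pselect (excess e l y); last first.
  by rewrite gap_out// powR0// !mulr0 !mule0 poweR0r ?invr_neq0// mul0e.
have g0 := gap_ge0 e l y; have u0 := u_gt0 y.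
rewrite [\1__ y]indicE mem_set// mul1r poweRM ?poweR_ge0 ?lee_fin ?powR_ge0//.
rewrite -!poweRrM !poweR_EFin -!powRrM mulfV// powRr1//.
rewrite (_ : q * ((beta - 1) / q) = beta - 1)%R; last by field.
rewrite muleACA -poweRD; last first.
  apply: add_neq0_poweRD_def; rewrite -mulrDr.
  by rewrite mulf_neq0// gt_eqF// ?divr_gt0// addr_gt0.
rewrite (_ : s * q^-1 + _ = 1)%R; last first.
  by field; rewrite (gt_eqF q0) (gt_eqF qb1).
by rewrite poweRe1// -EFinM mulrC.
Qed.

Let mgapq e l : measurable_fun setT (fun y => (gap e l y `^ q)%:E).
Proof.
apply/measurable_EFinP; apply: (measurableT_comp (@measurable_powR R q)).
exact: measurable_gap.
Qed.

Let gapq_ge0 e l y : 0 <= (gap e l y `^ q)%:E.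
Proof. by rewrite lee_fin powR_ge0. Qed.

Lemma gap_le_young e l x : sqn e = 1%R ->
  (gap e l x `^ q)%:E <= (beta `^ q)%:E *
   (Ks `^ (q - beta) * excess_mass e l `^ (beta - 1)) *
   \int[mu]_y (K (sqn (x - y)) `^ s * (gap e l y `^ q)%:E).
Proof.
move=> e1; set J := \int[mu]_y (K (sqn (x - y)) * (u y `^ (beta - 1) * gap e l y)%:E).
set F := \int[mu]_y (K (sqn (x - y)) `^ s * (gap e l y `^ q)%:E).
have F0 : 0 <= F by apply: integral_ge0 => y _; rewrite mule_ge0// poweR_ge0.
have J0 : 0 <= J.
  by apply: integral_ge0 => y _; rewrite mule_ge0// lee_fin mulr_ge0 ?powR_ge0 ?gap_ge0.
have M0 : 0 <= excess_mass e l.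
  by apply: integral_ge0 => y _; rewrite lee_fin mulr_ge0 ?powR_ge0.
have Ks0 : 0 <= Ks by apply: integral_ge0 => y _; exact: poweR_ge0.
have gJ : (gap e l x)%:E <= beta%:E * J.
  have bJ0 : 0 <= beta%:E * J by rewrite mule_ge0// lee_fin ltW.
  have [xE|xE] := pselect (excess e l x); last by rewrite gap_out.
  rewrite gap_in// EFinB leeBlDr//; have := half_space_le e1 xE.1.
  rewrite addeC; congr (_ <= _ + _).
  rewrite /J -ge0_integralZl//.
  - apply: eq_integral => y _; rewrite [RHS]muleCA.
    by congr (_ * _); rewrite -[RHS]EFinM -mulrA.
  - apply: emeasurable_funM => //; apply/measurable_EFinP.
    by apply: measurable_funM => //; exact: measurable_gap.
  - by move=> y _; rewrite mule_ge0// lee_fin mulr_ge0 ?powR_ge0 ?gap_ge0.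
  - by rewrite lee_fin ltW.
rewrite -poweR_EFin.
apply: (@le_trans _ _ ((beta%:E * J) `^ q)).
  have bJ0 : 0 <= beta%:E * J by rewrite mule_ge0// lee_fin ltW.
  by apply: gt0_ler_poweR => //; rewrite ?(ltW q0) ?in_itv/= ?leey ?andbT ?lee_fin ?gap_ge0.
rewrite poweRM ?lee_fin ?(ltW beta0)// poweR_EFin -muleA.
apply: lee_wpmul2l; first by rewrite lee_fin powR_ge0.
have bq0 : (0 <= q - beta)%R by rewrite subr_ge0 ltW.
rewrite [leRHS](_ : _ = (F `^ q^-1 *
    (Ks `^ (1 - beta / q) * excess_mass e l `^ ((beta - 1) / q))) `^ q).
  apply: gt0_ler_poweR; rewrite ?in_itv/= ?leey ?andbT ?(ltW q0)//.
    by rewrite !mule_ge0 ?poweR_ge0.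
  exact: young_gap.
rewrite !poweRM ?mule_ge0 ?poweR_ge0// -!poweRrM mulVf ?(gt_eqF q0)//.
rewrite poweRe1// muleC; congr (_ * (_ `^ _ * _ `^ _)).
  by rewrite mulrBl mul1r divfK// gt_eqF.
by rewrite divfK// gt_eqF.
Qed.

Lemma integral_gap_le e l : sqn e = 1%R ->
  \int[mu]_x (gap e l x `^ q)%:E <= (beta `^ q)%:E *
   (Ks `^ (q - beta) * excess_mass e l `^ (beta - 1)) *
   (Ks * \int[mu]_x (gap e l x `^ q)%:E).
Proof.
move=> e1; set C := _ * (_ * _).
have C0 : 0 <= C by rewrite mule_ge0 ?lee_fin ?powR_ge0// mule_ge0 ?poweR_ge0.
have gapC x : (gap e l x `^ q)%:E <=
    C * \int[mu]_y (K (sqn (x - y)) `^ s * (gap e l y `^ q)%:E).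
  exact: gap_le_young.
clearbody C.
pose F (p : 'rV[R]_n * 'rV[R]_n) :=
  K (sqn (p.1 - p.2)) `^ s * (gap e l p.2 `^ q)%:E.
have F0 p : 0 <= F p by rewrite mule_ge0 ?poweR_ge0.
have mF : measurable_fun setT F.
  apply: emeasurable_funM; first exact: measurable_fun_poweR.
  exact: (measurableT_comp (mgapq e l)).
have mFF := @measurable_fun_fubini_tonelli_F _ _ _ _ _ mu F mF F0.
have FF0 x : 0 <= \int[mu]_y F (x, y) by exact: integral_ge0.
apply: (@le_trans _ _ (\int[mu]_x (C * \int[mu]_y F (x, y)))).
  by apply: ge0_le_integral => //; exact: measurable_funeM.
rewrite (@ge0_integralZl _ _ _ mu _ measurableT _ mFF C (fun x _ => FF0 x) C0).
rewrite (fubini_tonelli F mF F0).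
have Ks0 : 0 <= Ks by apply: integral_ge0 => x _; exact: poweR_ge0.
have E : Ks * \int[mu]_x (gap e l x `^ q)%:E = \int[mu]_x (Ks * (gap e l x `^ q)%:E).
  by rewrite (@ge0_integralZl _ _ _ mu _ measurableT _ (mgapq e l) Ks
    (fun x _ => gapq_ge0 e l x) Ks0).
have inner y : \int[mu]_x F (x, y) = Ks * (gap e l y `^ q)%:E.
  have my : measurable_fun setT (fun x => K (sqn (x - y)) `^ s).
    apply: measurable_fun_poweR; apply: (measurableT_comp mK).
    by apply: measurable_sqn; exact: measurable_subv.
  rewrite -(integral_Ks' y).
  exact: (@ge0_integralZr _ _ _ mu _ measurableT _ my _
    (fun x _ => poweR_ge0 _ _) (gapq_ge0 e l y)).
rewrite E (eq_integral (fun y => Ks * (gap e l y `^ q)%:E)); first exact: lexx.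
by move=> y _; exact: inner.
Qed.

Lemma small_excess : exists2 eps : R, (0 < eps)%R & forall e l, sqn e = 1%R ->
  excess_mass e l < eps%:E -> forall x, (l < dotv x e)%R ->
  (u x <= u (refl e l x))%R.
Proof.
have Ks0 : 0 <= Ks by apply: integral_ge0 => y _; exact: poweR_ge0.
have [k kE] : exists k : R, Ks = k%:E.
  by exists (fine Ks); rewrite fineK// ge0_fin_numE.
have k0 : (0 <= k)%R by rewrite -lee_fin -kE.
pose C : R := (beta `^ q * k `^ (q - beta) * k)%R.
have C0 : (0 <= C)%R by rewrite !mulr_ge0 ?powR_ge0.
have C1 : (0 < C + 1)%R by rewrite ltr_wpDl.
have bB : (0 < beta - 1)%R by rewrite subr_gt0.
pose eps : R := ((C + 1)^-1 `^ (beta - 1)^-1)%R.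
exists eps; first by rewrite powR_gt0// invr_gt0.
move=> e l e1 small; apply: half_space_gap0 => //.
have M0 : 0 <= excess_mass e l.
  by apply: integral_ge0 => y _; rewrite lee_fin mulr_ge0 ?powR_ge0.
have [m mE] : exists m : R, excess_mass e l = m%:E.
  by exists (fine (excess_mass e l)); rewrite fineK// ge0_fin_numE// (lt_trans small)// ltry.
have m0 : (0 <= m)%R by rewrite -lee_fin -mE.
have Cm : (C * m `^ (beta - 1) < 1)%R.
  have : (m `^ (beta - 1) <= (C + 1)^-1)%R.
    rewrite (_ : (C + 1)^-1 = eps `^ (beta - 1))%R; last first.
      by rewrite /eps -powRrM mulVf ?gt_eqF// powRr1// invr_ge0 ltW.
    rewrite ge0_ler_powR ?(ltW bB) ?nnegrE ?powR_ge0// ltW//.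
    by rewrite -lte_fin -mE.
  move=> /(ler_wpM2l C0)/le_lt_trans; apply.
  by rewrite ltr_pdivrMr// mul1r ltrDl.
have Z0 : 0 <= \int[mu]_x (gap e l x `^ q)%:E by exact: integral_ge0.
have Zy : \int[mu]_x (gap e l x `^ q)%:E < +oo.
  apply: le_lt_trans u_lty; apply: ge0_le_integral => //.
  - by apply/measurable_EFinP.
  - move=> x _; rewrite lee_fin ge0_ler_powR ?(ltW q0) ?nnegrE ?gap_ge0 ?gap_le//.
    exact: ltW.
have := integral_gap_le l e1; rewrite kE mE !poweR_EFin.
have [z zE] : exists z : R, \int[mu]_x (gap e l x `^ q)%:E = z%:E.
  by exists (fine (\int[mu]_x (gap e l x `^ q)%:E)); rewrite fineK// ge0_fin_numE.
rewrite zE -!EFinM lee_fin => zC; rewrite zE lee_fin in Z0.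
have {}zE : \int[mu]_x (gap e l x `^ q)%:E = 0.
  rewrite zE; congr EFin; apply/eqP; rewrite eq_le Z0 andbT leNgt; apply/negP => z0.
  have : (C * m `^ (beta - 1) * z < z)%R by rewrite gtr_pMl.
  rewrite ltNge => /negP; apply; apply: (le_trans zC).
  by rewrite le_eqVlt /C; apply/orP; left; apply/eqP; ring.
have := ge0_integral_eq0_ae (mgapq e l) (gapq_ge0 e l) zE.
apply: filterS => x [] /eqP; rewrite powR_eq0 => /andP[/eqP//].
Qed.

Lemma half_space_strict e l x : sqn e = 1%R ->
  (forall y, (l < dotv y e)%R -> (u y <= u (refl e l y))%R) ->
  (l < dotv x e)%R -> u (refl e l x) = u x -> forall z, u (refl e l z) = u z.
Proof.
move=> e1 P xl ux z.
pose a y := K (sqn (x - y)); pose b y := K (sqn (x - refl e l y)).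
pose U y := (u y `^ beta)%:E; pose V y := (u (refl e l y) `^ beta)%:E.
have U0 y : 0 <= U y by rewrite lee_fin powR_ge0.
have V0 y : 0 <= V y by rewrite lee_fin powR_ge0.
have a0 y : 0 <= a y by exact: K_ge0.
have b0 y : 0 <= b y by exact: K_ge0.
have mb : measurable_fun setT b by exact: (measurableT_comp (mKsub x)).
have mU : measurable_fun setT U by exact/measurable_EFinP.
have mV : measurable_fun setT V by exact: (measurableT_comp mU).
have mp f g : measurable_fun setT f -> measurable_fun setT g ->
  measurable_fun setT (fun y : 'rV[R]_n => f y * g y :> \bar R) by exact: emeasurable_funM.
have ma : measurable_fun setT a by exact: mKsub.
have IaU : \int[mu]_y (a y * U y) = (u x)%:E by rewrite -u_eq.
have IbV : \int[mu]_y (b y * V y) = (u x)%:E.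
  rewrite -IaU; apply: (integral_refl l e1 (mp _ _ ma mU)) => y.
  by rewrite mule_ge0.
have IbU : \int[mu]_y (b y * U y) = (u x)%:E.
  by rewrite -ux u_eq; apply: eq_integral => y _; rewrite sub_refl.
have IaV : \int[mu]_y (a y * V y) = (u x)%:E.
  rewrite -IbU -(integral_refl l e1 (mp _ _ mb mU)); last by move=> y; rewrite mule_ge0.
  by apply: eq_integral => y _; rewrite /b reflK.
have ind y : (l < dotv y e)%R -> a y * U y + b y * V y <= b y * U y + a y * V y.
  move=> yl; apply: lee_rearrange => //; last exact/le_upow/P.
    by apply: K_refl => //; exact: ltW.
  by rewrite powR_gt0.
have trich y : [\/ (l < dotv y e)%R, (l < dotv (refl e l y) e)%R | refl e l y = y].
  rewrite dotv_refl//; case: (ltgtP l (dotv y e)) => h.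
  - exact: Or31.
  - by apply: Or32; lra.
  - by apply: Or33; rewrite refl_fix.
have sw y : [/\ a (refl e l y) = b y, b (refl e l y) = a y,
    U (refl e l y) = V y & V (refl e l y) = U y].
  by split=> //; rewrite /b /V reflK.
have inq y : a y * U y + b y * V y <= b y * U y + a y * V y.
  have [|/ind|yE] := trich y; first exact: ind.
    have [-> -> -> ->] := sw y.
    by rewrite addeC [leRHS]addeC.
  by rewrite /a /b /U /V yE.
have aefin : {ae mu, forall y, a y \is a fin_num /\ b y \is a fin_num}.
  have k1 : {ae mu, forall y, a y * U y \is a fin_num}.
    apply: ge0_integral_lty_ae; [exact: mp|by move=> y; rewrite mule_ge0|].
    by rewrite IaU ltry.
  have k2 : {ae mu, forall y, b y * V y \is a fin_num}.
    apply: ge0_integral_lty_ae; [exact: mp|by move=> y; rewrite mule_ge0|].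
    by rewrite IbV ltry.
  have fin (c : \bar R) (r : R) : (0 < r)%R -> 0 <= c -> c * r%:E \is a fin_num -> c \is a fin_num.
    by case: c => // r0 _; rewrite gt0_mulye.
  apply: filterS2 k1 k2 => y /fin h1 /fin h2.
  by split; [apply: h1|apply: h2] => //; rewrite powR_gt0.
have aeE : {ae mu, forall y, a y * U y + b y * V y = b y * U y + a y * V y}.
  have m0 f g : (forall y, 0 <= f y) -> (forall y, 0 <= g y) ->
    forall y : 'rV[R]_n, 0 <= f y * g y :> \bar R by move=> f0 g0 y; exact: mule_ge0.
  apply: ge0_integral_le_ae_eq => //.
  - by apply: emeasurable_funD; exact: mp.
  - by apply: emeasurable_funD; exact: mp.
  - by move=> y; rewrite adde_ge0// m0.
  - rewrite ge0_integralD//; try by [move=> y _; exact: m0|exact: mp].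
    by rewrite IaU IbV -EFinD ltry.
  - rewrite !ge0_integralD//; try by [move=> y _; exact: m0|exact: mp].
    by rewrite IaU IbV IbU IaV.
have solve y : (l < dotv y e)%R -> a y \is a fin_num -> b y \is a fin_num ->
    a y * U y + b y * V y = b y * U y + a y * V y -> U y = V y.
  move=> yl ay by_ E.
  have : b y < a y.
    apply: K_lt; last by rewrite ltey_eq -/(a y) ay.
    rewrite sqn_sub_refl// ltrDl.
    by rewrite !mulr_gt0// subr_gt0.
  move: E; rewrite /U /V; move: (a y) (b y) ay by_ => [r| |] [t| |]// _ _.
  rewrite lte_fin -!EFinM -!EFinD => -[E] tr; congr EFin.
  have /eqP : ((r - t) * (u y `^ beta - u (refl e l y) `^ beta) = 0)%R by lra.
  by rewrite mulf_eq0 subr_eq0 (gt_eqF tr)/= subr_eq0 => /eqP.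
have UV : {ae mu, forall y, U y = V y}.
  apply: filterS2 aefin aeE => y [ay by_] E.
  have [yl|yl|yE] := trich y; first exact: solve.
    have := solve _ yl; have [-> -> -> ->] := sw y => /(_ by_ ay).
    by rewrite addeC E addeC => /(_ erefl).
  by rewrite /U /V yE.
apply: EFin_inj; rewrite [RHS]u_eq u_eq.
have mc : measurable_fun setT (fun y => K (sqn (z - refl e l y))).
  exact: (measurableT_comp (mKsub z)).
transitivity (\int[mu]_y (K (sqn (z - refl e l y)) * U y)).
  by apply: eq_integral => y _; rewrite sub_refl.
rewrite -(integral_refl l e1 (mp _ _ mc mU)); last first.
  by move=> y; rewrite mule_ge0.
apply: ge0_ae_eq_integral => //.
- exact: (measurableT_comp (mp _ _ mc mU)).
- exact: mp.
- by move=> y _ /=; apply: mule_ge0; [exact: K_ge0|exact: U0].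
- by move=> y _ /=; apply: mule_ge0; [exact: K_ge0|exact: U0].
- by apply: filterS UV => y UVy _ /=; rewrite reflK//; congr (_ * _); exact: esym.
Qed.

Lemma u_lsc (z_ : nat -> 'rV[R]_n) z (c : R) :
  (forall y, sqn (z_ k - y) @[k --> \oo] --> sqn (z - y)) -> (c < u z)%R ->
  \forall k \near \oo, (c < u (z_ k))%R.
Proof.
move=> zz; rewrite -lte_fin => cu.
have : c%:E < limn_einf (fun k => (u (z_ k))%:E).
  apply: (lt_le_trans cu); rewrite u_eq.
  rewrite (_ : (fun k => _) = fun k =>
    \int[mu]_y (K (sqn (z_ k - y)) * (u y `^ beta)%:E)); last exact/funext.
  have mf k : measurable_fun setT (fun y => K (sqn (z_ k - y)) * (u y `^ beta)%:E).
    by apply: emeasurable_funM => //; exact/measurable_EFinP.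
  have f0 k y : 0 <= K (sqn (z_ k - y)) * (u y `^ beta)%:E.
    by rewrite mule_ge0// lee_fin powR_ge0.
  apply: le_trans (fatou mu measurableT mf (fun k y _ => f0 k y)).
  have h y : K (sqn (z - y)) * (u y `^ beta)%:E <=
      limn_einf (fun k => K (sqn (z_ k - y)) * (u y `^ beta)%:E).
    rewrite muleC; have := K_lsc (powR_ge0 (u y) beta) (zz y).
    by under eq_fun do rewrite muleC.
  apply: ge0_le_integral => //.
  - by move=> y _; rewrite mule_ge0// lee_fin powR_ge0.
  - by apply: emeasurable_funM => //; exact/measurable_EFinP.
  - rewrite /limn_einf; apply: measurableT_comp => //.
    apply: measurable_fun_limn_esup => k.
    exact: measurableT_comp.
by move=> /limn_einf_gt_near; apply: filterS => k; rewrite lte_fin.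
Qed.

Lemma sqn_refl_cvg e (l_ : R^nat) l x y : l_ @ \oo --> l ->
  sqn (refl e (l_ k) x - y) @[k --> \oo] --> sqn (refl e l x - y).
Proof.
move=> ll.
have E m : sqn (refl e m x - y) = (sqn (x - y) + 4 * dotv (x - y) e * (m - dotv x e) +
    4 * sqn e * (m - dotv x e) ^+ 2)%R.
  by rewrite /refl addrAC; move: (x - y)%R => w; rewrite /sqn !dotvE (dotvC e w); ring.
rewrite E; under eq_fun do rewrite E.
have d : (l_ k - dotv x e)%R @[k --> \oo] --> (l - dotv x e)%R.
  by apply: cvgB => //; exact: cvg_cst.
apply: cvgD; last by apply: cvgM; [exact: cvg_cst|exact: cvgM].
by apply: cvgD; [exact: cvg_cst|apply: cvgM => //; exact: cvg_cst].
Qed.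

Lemma mass_cvg0 (A : nat -> set 'rV[R]_n) : (forall k, measurable (A k)) ->
  {ae mu, forall x, \forall k \near \oo, ~ A k x} ->
  \int[mu]_x (\1_(A k) x * u x `^ q)%:E @[k --> \oo] --> 0.
Proof.
move=> mA A0.
have mg : measurable_fun setT (fun x => (u x `^ q)%:E) by exact/measurable_EFinP.
have ig : mu.-integrable setT (fun x => (u x `^ q)%:E).
  apply/integrableP; split=> //.
  by under eq_integral do rewrite gee0_abs ?lee_fin ?powR_ge0//.
have mf k : measurable_fun setT (fun x => (\1_(A k) x * u x `^ q)%:E).
  by apply/measurable_EFinP; apply: measurable_funM => //; exact: measurable_indic.
have f_f : {ae mu, forall x, setT x -> (\1_(A k) x * u x `^ q)%:E @[k --> \oo] --> cst 0 x}.
  apply: filterS A0 => x Ax _; apply: cvg_near_cst.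
  by apply: filterS Ax => k Akx; rewrite indicE memNset// mul0r.
have f_g : {ae mu, forall x k, setT x -> `|(\1_(A k) x * u x `^ q)%:E| <= (u x `^ q)%:E}.
  apply: aeW => x k _; rewrite lee_fin ger0_norm ?mulr_ge0 ?powR_ge0//.
  by rewrite ler_piMl ?powR_ge0// indicE; case: (_ \in _).
have [_ _] := dominated_convergence measurableT mf (@measurable_cst _ _ _ _ setT 0) f_f ig f_g.
by rewrite integral0.
Qed.

Lemma no_translation v : v != 0%R -> ~ (forall x, (u (x + v) <= u x)%R).
Proof.
move=> v0 mono; have c0 : (0 < sqn v)%R by rewrite lt_neqAle sqn_ge0 eq_sym sqn_eq0 v0.
pose A (t : R) : set 'rV[R]_n := [set x | (dotv x v < t)%R].
have mA t : measurable (A t).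
  have m : measurable_fun setT (fun x => dotv x v < t)%R.
    by apply: measurable_fun_ltr => //; exact: measurable_dotv.
  by have := m measurableT [set true] I; rewrite setTI.
pose M t := \int[mu]_x (\1_(A t) x * u x `^ q)%:E.
have mM t : measurable_fun setT (fun x => (\1_(A t) x * u x `^ q)%:E).
  by apply/measurable_EFinP; apply: measurable_funM => //; exact: measurable_indic.
have M_ge0 t x : 0 <= (\1_(A t) x * u x `^ q)%:E by rewrite lee_fin mulr_ge0 ?powR_ge0.
have step t : M t <= M (t - sqn v)%R.
  rewrite /M -[leLHS](integral_rV_shift v (mM t) (M_ge0 t)).
  apply: ge0_le_integral => //.
    by apply: (measurableT_comp (mM t)); exact: measurable_addv.
  move=> x _; rewrite lee_fin !indicE.
  have -> : ((x + v)%R \in A t) = (x \in A (t - sqn v)%R).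
    by apply/idP/idP; rewrite !inE /A/= dotvDl -/(sqn v) ltrBrDr.
  by rewrite ler_wpM2l// ge0_ler_powR ?(ltW q0) ?nnegrE ?(ltW (u_gt0 _)).
have stepn t k : M t <= M (t - k%:R * sqn v)%R.
  elim: k => [|k IH]; first by rewrite mul0r subr0.
  by rewrite (le_trans IH)// (le_trans (step _))// -natr1 mulrDl mul1r opprD addrA.
have M0 t : M t = 0.
  apply/eqP; rewrite eq_le; apply/andP; split; last exact: integral_ge0.
  have cv : M (t - k%:R * sqn v)%R @[k --> \oo] --> 0.
    apply: mass_cvg0 => //; apply: aeW => x.
    near=> k; rewrite /A/=; apply/negP; rewrite -leNgt lerBlDr -lerBlDl.
    rewrite -ler_pdivrMr//; near: k.
    exact: (@nbhs_infty_ger R ((t - dotv x v) / sqn v)%R).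
  by apply: (cvge_ge _ cv); exists 0%N => // k _; exact: stepn.
have : {ae mu, forall x (k : nat), (\1_(A k%:R) x * u x `^ q)%:E = 0}.
  apply/ae_foralln => k.
  exact: (ge0_integral_eq0_ae (mM k%:R%R) (M_ge0 k%:R%R) (M0 k%:R%R)).
move=> ae0; have := u_gt0 0%R; rewrite -lte_fin u_eq.
rewrite (ge0_ae_eq_integral _ _ (@measurable_cst _ _ _ _ setT 0))//.
- by rewrite integral0 ltxx.
- by apply: emeasurable_funM => //; exact/measurable_EFinP.
- by move=> y _; rewrite mule_ge0// lee_fin powR_ge0.
- apply: filterS ae0 => y h _; exfalso.
  have [k yk] : exists k : nat, (dotv y v < k%:R)%R.
    exists (Num.bound `|dotv y v|%R).
    exact: le_lt_trans (ler_norm _) (archi_boundP (normr_ge0 _)).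
  have := h k; rewrite indicE mem_set// mul1r => -[] /eqP.
  by rewrite powR_eq0 (gt_eqF (u_gt0 y)).
Unshelve. all: by end_near. Qed.

Definition half_space e l := forall x, (l < dotv x e)%R -> (u x <= u (refl e l x))%R.

Lemma half_space_near_infinity e : sqn e = 1%R ->
  exists l0, forall l, (l0 <= l)%R -> half_space e l.
Proof.
move=> e1; have [eps eps0 small] := small_excess.
pose A (t : R) : set 'rV[R]_n := [set x | (t < dotv x e)%R].
have mA t : measurable (A t).
  have m : measurable_fun setT (fun x => t < dotv x e)%R.
    by apply: measurable_fun_ltr => //; exact: measurable_dotv.
  by have := m measurableT [set true] I; rewrite setTI.
have cv : \int[mu]_x (\1_(A k%:R) x * u x `^ q)%:E @[k --> \oo] --> 0.
  apply: mass_cvg0 => //; apply: aeW => x.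
  near=> k; rewrite /A/=; apply/negP; rewrite -leNgt.
  by near: k; exact: nbhs_infty_ger.
have [N _ /(_ N (leqnn N)) /= hN] : \forall k \near \oo,
    \int[mu]_x (\1_(A k%:R) x * u x `^ q)%:E < eps%:E.
  exact: cvge0_lt_near.
exists N%:R => l Nl; apply: small => //; apply: le_lt_trans hN.
apply: ge0_le_integral => //.
- by move=> x _; rewrite lee_fin mulr_ge0 ?powR_ge0.
- apply/measurable_EFinP; apply: measurable_funM => //.
  by apply: measurable_indic; exact: measurable_excess.
- by apply/measurable_EFinP; apply: measurable_funM => //; exact: measurable_indic.
move=> x _; rewrite lee_fin ler_wpM2r ?powR_ge0//.
have [xE|xE] := pselect (excess e l x); last by rewrite indicE memNset.
rewrite !indicE mem_set// mem_set//.
exact: le_lt_trans Nl xE.1.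
Unshelve. all: by end_near. Qed.

Lemma not_half_space e : sqn e = 1%R -> exists l, ~ half_space e l.
Proof.
move=> e1; apply: contrapT => /forallNP P.
apply: (@no_translation e); first by rewrite -sqn_eq0 e1 oner_eq0.
move=> x; have /contrapT/(_ (x + e)%R) := P (dotv x e + 2^-1)%R.
rewrite /refl !dotvE -/(sqn e) e1 => /(_ _)/le_trans; apply; first lra.
rewrite (_ : 2 * _ = -1)%R; last by field.
by rewrite scaleN1r addrK.
Qed.

Lemma moving_plane e : sqn e = 1%R ->
  exists l, (forall m, (l <= m)%R -> half_space e m) /\
            forall x, u (refl e l x) = u x.
Proof.
move=> e1; have [L0 L0P] := half_space_near_infinity e1.
have [b bP] := not_half_space e1.
pose S : set R := [set l | forall m, (l <= m)%R -> half_space e m].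
have hS : has_inf S.
  split; first by exists L0.
  exists b => l Sl; rewrite leNgt; apply/negP => lb.
  by apply: bP; apply: Sl; exact: ltW.
pose l := inf S.
have gtP m : (l < m)%R -> half_space e m.
  by move=> /(inf_lt hS.1)[m' Sm' m'm]; apply: Sm'; exact: ltW.
have lP : half_space e l.
  move=> x lx; rewrite leNgt; apply/negP => ux.
  set z := refl e l x in ux.
  pose m_ (k : nat) := (l + k.+1%:R^-1)%R.
  have ml : m_ k @[k --> \oo] --> l.
    rewrite -[X in _ --> X]addr0; apply: cvgD; first exact: cvg_cst.
    exact: cvg_harmonic.
  have := @u_lsc (fun k => refl e (m_ k) z) x (u z) _ ux.
  case.
    by move=> y; rewrite -(reflK l e1 x); exact: sqn_refl_cvg.
  move=> N _ /(_ N (leqnn N)) /=; rewrite ltNge => /negP; apply.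
  have zl : (dotv z e < l)%R by rewrite /z dotv_refl//; lra.
  have lm : (l < m_ N)%R by rewrite /m_ ltrDl invr_gt0.
  rewrite -[in leRHS](reflK (m_ N) e1 z); apply: gtP => //.
  by rewrite dotv_refl//; lra.
have geP m : (l <= m)%R -> half_space e m.
  by rewrite le_eqVlt => /predU1P[<-//|]; exact: gtP.
exists l; split=> //.
apply: contrapT => /existsNP[x0 ux0].
have strict x : (l < dotv x e)%R -> (u x < u (refl e l x))%R.
  move=> lx; rewrite lt_neqAle lP// andbT; apply/eqP => ux.
  by apply: ux0; apply: (half_space_strict e1 lP lx); rewrite ux.
have [eps eps0 small] := small_excess.
have /choice[l_ l_P] : forall k : nat, exists m,
    [/\ (l - k.+1%:R^-1 <= m)%R, (m < l)%R & ~ half_space e m].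
  move=> k; apply: contrapT => /forallNP h.
  have : S (l - k.+1%:R^-1)%R.
    move=> m km; have [lm|ml] := leP l m; first exact: geP.
    by have := h m; apply: contra_notP => nm; split.
  move=> /(ge_inf hS.2); rewrite -/l leNgt => /negP; apply.
  by rewrite ltrBlDr ltrDl invr_gt0.
have l_l : l_ @ \oo --> l.
  apply: (@squeeze_cvgr _ _ _ _ (fun k : nat => l - k.+1%:R^-1)%R (cst l)).
  - by apply: nearW => k; have [-> /ltW ->] := l_P k.
  - rewrite -[X in _ --> X]subr0; apply: cvgB; first exact: cvg_cst.
    exact: cvg_harmonic.
  - exact: cvg_cst.
have cv : excess_mass e (l_ k) @[k --> \oo] --> 0.
  apply: mass_cvg0; first by move=> k; exact: measurable_excess.
  exists [set x | dotv x e = l]; split.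
  - have m : measurable_fun setT (fun x => dotv x e) by exact: measurable_dotv.
    by have := m measurableT [set l] (measurable_set1 _); rewrite setTI.
  - exact: hyperplane_null.
  move=> x /= h; apply: contrapT => /eqP; rewrite neq_lt => /orP[xl|lx]; apply: h.
    have : \forall k \near \oo, (dotv x e < l_ k)%R by exact: (cvgr_gt l).
    by apply: filterS => k xk [/lt_trans/(_ xk)]; rewrite ltxx.
  have : \forall k \near \oo, (u x < u (refl e (l_ k) x))%R.
    apply: (@u_lsc (fun k => refl e (l_ k) x) (refl e l x)); last exact: strict.
    by move=> y; exact: sqn_refl_cvg.
  by apply: filterS => k xk [_ /lt_trans/(_ xk)]; rewrite ltxx.
have [N _ /(_ N (leqnn N)) /= hN] := cvge0_lt_near eps0 cv.
have [_ _] := l_P N; apply => x xN; exact: (small e (l_ N)).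
Qed.

End integral_equation.

(** * From planes of symmetry to radial symmetry *)

Section radial.
Context {R : realType} {n : nat}.
Variable u : 'rV[R]_n -> R.
Hypothesis n_gt0 : (0 < n)%N.
Hypothesis plane : forall e, sqn e = 1 -> exists l,
  (forall m, l <= m -> forall x, m < dotv x e -> u x <= u (refl e m x)) /\
  (forall x, u (refl e l x) = u x).
Hypothesis translation : forall v, v != 0 -> ~ (forall x, u (x + v) <= u x).

Let ei (i : 'I_n) : 'rV[R]_n := delta_mx ord0 i.

Let dotv_ei x i : dotv x (ei i) = x ord0 i.
Proof.
rewrite /dotv (bigD1 i)//= big1 ?addr0 => [|j ji]; rewrite mxE !eqxx/= ?mulr1//.
by rewrite (negPf ji) mulr0.
Qed.

Let sqn_ei i : sqn (ei i) = 1.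
Proof. by rewrite /sqn dotv_ei mxE !eqxx. Qed.

Lemma point_symmetry : exists x0, forall x, u (x0 + x0 - x) = u x.
Proof.
have /choice[l lP] : forall i, exists l, forall x, u (refl (ei i) l x) = u x.
  by move=> i; have [l [_ h]] := plane (sqn_ei i); exists l.
exists (\row_i l i) => x.
pose part (s : seq 'I_n) : 'rV[R]_n :=
  \row_i (if i \in s then l i + l i - x ord0 i else x ord0 i).
have partP s : uniq s -> u (part s) = u x.
  elim: s => [_|i s IH /= /andP[si /IH <-]].
    by congr u; apply/rowP => i; rewrite mxE.
  rewrite -(lP i (part s)); congr u; apply/rowP => j.
  rewrite !mxE dotv_ei mxE (negPf si) in_cons eqxx/=.
  case: eqVneq => [->|ji] /=; last by rewrite mulr0 addr0.
  by rewrite (negPf si); ring.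
rewrite -(partP (enum 'I_n)) ?enum_uniq//; congr u; apply/rowP => i.
by rewrite !mxE mem_enum.
Qed.

Lemma plane_through_center x0 e : (forall x, u (x0 + x0 - x) = u x) ->
  sqn e = 1 ->
  (forall m, dotv x0 e <= m -> forall x, m < dotv x e -> u x <= u (refl e m x)) /\
  (forall x, u (refl e (dotv x0 e) x) = u x).
Proof.
move=> sym e1; have [l [lP lS]] := plane e1.
have [<-//|ld] := eqVneq l (dotv x0 e).
exfalso; have v0 : (4 * (l - dotv x0 e)) *: e != 0.
  rewrite scaler_eq0 negb_or mulf_neq0 ?subr_eq0 ?pnatr_eq0//=.
  by rewrite -sqn_eq0 e1 oner_eq0.
apply: (translation v0) => x.
rewrite le_eqVlt; apply/orP; left; apply/eqP.
(* Two reflections and two central symmetries compose to a translation. *)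
rewrite -[RHS]sym -[RHS]lS -[RHS]sym -[RHS]lS; congr u; apply/rowP => i.
rewrite /refl !dotvE -/(sqn e) e1 !mxE; ring.
Qed.

Lemma eq_radius x0 x y : (forall x, u (x0 + x0 - x) = u x) ->
  sqn (x - x0) = sqn (y - x0) -> u x = u y.
Proof.
move=> sym xy; have [->//|nxy] := eqVneq x y.
set w := x - y; pose r := enorm w.
have w0 : sqn w != 0 by rewrite sqn_eq0 subr_eq0.
have r2 : r ^+ 2 = sqn w by exact: sqr_enorm.
have r0 : r != 0 by apply: contra_neq w0 => r0; rewrite -r2 r0 expr0n.
pose e := r^-1 *: w.
have e1 : sqn e = 1.
  by rewrite /sqn /e dotvZl dotvZr -/(sqn w) -r2; field.
have [_ <-] := plane_through_center sym e1; congr u.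
have wE : 2 * (dotv x0 w - dotv x w) = - sqn w.
  move: xy; rewrite /w /sqn !dotvE (dotvC y x) (dotvC x0 x) (dotvC x0 y) => h.
  lra.
have -> : refl e (dotv x0 e) x = x + (2 * (dotv x0 w - dotv x w) / r ^+ 2) *: w.
  rewrite /refl /e !dotvZr scalerA; congr (_ + _ *: _); field.
  exact: r0.
by rewrite wE r2 mulNr divff// scaleN1r /w opprB addrC subrK.
Qed.

Lemma radial_decreasing : exists (x0 : 'rV[R]_n) (phi : R -> R),
  (forall r s : R, 0 <= r -> r <= s -> phi s <= phi r) /\
  (forall x : 'rV[R]_n, u x = phi (enorm (x - x0))).
Proof.
have [x0 sym] := point_symmetry; have := sqn_ei (Ordinal n_gt0).
set e := ei _ => e1.
exists x0, (fun r => u (x0 + r *: e)); split=> [r s r0|x]; last first.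
  apply: (eq_radius sym); rewrite [x0 + _]addrC addrK.
  by rewrite [in RHS]/sqn !dotvE -/(sqn e) e1 mulr1 -expr2 sqr_enorm.
rewrite le_eqVlt => /predU1P[->//|rs].
have [half _] := plane_through_center sym e1.
apply: le_trans (half (dotv x0 e + (r + s) / 2) _ (x0 + s *: e) _) _.
- by lra.
- by rewrite !dotvE -/(sqn e) e1; lra.
rewrite le_eqVlt; apply/orP; left; apply/eqP; congr u; apply/rowP => i.
by rewrite /refl !dotvE -/(sqn e) e1 !mxE; field.
Qed.

End radial.

Lemma Lfun_integral_powR_lty d (T : measurableType d) (R : realType)
    (m : {measure set T -> \bar R}) (q : R) (f : T -> R) :
  0 < q -> (forall x, 0 <= f x) -> f \in Lfun m q%:E ->
  (\int[m]_x (f x `^ q)%:E < +oo)%E.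
Proof.
move=> q0 f0 /andP[_]; rewrite inE /= /finite_norm.
have -> : Lnorm m q%:E (EFin \o f) = ((\int[m]_x (f x `^ q)%:E) `^ q^-1)%E.
  rewrite unlock; apply: (congr1 (fun z => poweR z q^-1)); apply: eq_integral => x _.
  by rewrite /= ger0_norm.
by apply: lty_poweRy; rewrite invr_neq0// gt_eqF.
Qed.

Section main.
Context {R : realType} {n : nat}.
Notation mu := (lebesgue_rV R n).
Local Open Scope ereal_scope.

Lemma bessel_gamma_ge0 (alpha : R) : (0 <= bessel_gamma alpha)%R.
Proof.
rewrite mulr_ge0 ?powR_ge0// /Gamma /Rintegral fine_ge0// integral_ge0// => t _.
by rewrite lee_fin mulr_ge0 ?powR_ge0 ?expR_ge0.
Qed.

Lemma measurable_bessel_kernel (alpha : R) :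
  measurable_fun [set: 'rV[R]_n] (@bessel_kernel R n alpha).
Proof.
rewrite (_ : bessel_kernel _ = fun x : 'rV[R]_n =>
  (bessel_gamma alpha)^-1%:E * @bprofile R n alpha (sqn x)); last first.
  by apply/funext => x; exact: bessel_kernelE.
apply: measurable_funeM; apply: (measurableT_comp (measurable_bprofile alpha)).
exact: measurable_sqn.
Qed.

Lemma bessel_kernel_ge0 (alpha : R) (x : 'rV[R]_n) : 0 <= bessel_kernel alpha x.
Proof.
by rewrite bessel_kernelE mule_ge0 ?bprofile_ge0// lee_fin invr_ge0 bessel_gamma_ge0.
Qed.

Lemma positive_solution_measurable (alpha beta : R) (u : lebesgue_type R n -> R) :
  positive_solution alpha beta u -> measurable_fun setT (u : 'rV[R]_n -> R).
Proof.
move=> [mu_u u0 uE]; apply/measurable_EFinP.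
pose m2 : {sigma_finite_measure set (lebesgue_type R n) -> \bar R} :=
  HB.pack (@completed_measure_extension _ _ _ (lebesgue_rV R n))
    (Measure_isSigmaFinite.Build _ _ _
      (@completed_measure_extension _ _ _ (lebesgue_rV R n))
      (@completed_sigma_finite R n)).
pose f (p : 'rV[R]_n * lebesgue_type R n) :=
  bessel_kernel alpha (p.1 - (p.2 : 'rV[R]_n))%R * (u p.2 `^ beta)%:E.
have f0 p : 0 <= f p.
  by rewrite mule_ge0 ?bessel_kernel_ge0// lee_fin powR_ge0.
have mf : measurable_fun setT f.
  apply: emeasurable_funM.
    apply: (measurableT_comp (measurable_bessel_kernel alpha)).
    apply: measurable_subv => //.
    exact: (measurableT_comp (@measurable_lebesgue_id R n) measurable_snd).
  apply/measurable_EFinP; apply: (measurableT_comp (@measurable_powR R beta)).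
  exact: (measurableT_comp mu_u).
have -> : EFin \o u = fubini_F m2 f.
  by apply/funext => x; rewrite /= uE.
exact: measurable_fun_fubini_tonelli_F.
Qed.

End main.

Theorem theorem1 (R : realType) (n : nat) (alpha beta q : R)
    (u : lebesgue_type R n -> R)
    (hn : (1 <= n)%N) (halpha : 0 < alpha) (hbeta : 1 < beta)
    (hq : Num.max beta (n%:R * (beta - 1) / alpha) < q)
    (hLq : u \in Lfun (completed_lebesgue_rV R n) q%:E)
    (hu : positive_solution alpha beta u) :
  exists (x0 : 'rV[R]_n) (phi : R -> R),
    (forall r s : R, 0 <= r -> r <= s -> phi s <= phi r) /\
    (forall x : 'rV[R]_n, u x = phi (enorm (x - x0))).
Proof.
have mu_u := positive_solution_measurable hu.
have [_ u0 uE] := hu.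
move: hq; rewrite gt_max => /andP[qbeta qn].
have q0 : 0 < q by rewrite (lt_trans _ qbeta)// (lt_trans _ hbeta).
pose c : R := (bessel_gamma alpha)^-1.
pose K (r : R) : \bar R := (c%:E * @bprofile R n alpha r)%E.
have c_ge0 : 0 <= c by rewrite invr_ge0 bessel_gamma_ge0.
have kE (x : 'rV[R]_n) : bessel_kernel alpha x = K (sqn x).
  exact: bessel_kernelE.
have mKU (x : 'rV[R]_n) : measurable_fun setT
    (fun y : 'rV[R]_n => K (sqn (x - y)) * (u y `^ beta)%:E)%E.
  apply: emeasurable_funM; last first.
    apply/measurable_EFinP.
    exact: (measurableT_comp (@measurable_powR R beta) mu_u).
  under eq_fun do rewrite -kE.
  apply: (measurableT_comp (measurable_bessel_kernel alpha)).
  exact: measurable_subv.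
have u_eq (x : 'rV[R]_n) :
    ((u x)%:E = \int[lebesgue_rV R n]_y (K (sqn (x - y)) * (u y `^ beta)%:E))%E.
  rewrite uE -(integral_completed (mKU x)).
    by apply: eq_integral => y _; rewrite kE.
  by move=> y; rewrite -kE mule_ge0 ?bessel_kernel_ge0// lee_fin powR_ge0.
have c0 : 0 < c.
  rewrite lt_neqAle c_ge0 andbT; apply/eqP => c0.
  have := u0 (0 : 'rV[R]_n); rewrite -lte_fin u_eq /K -c0.
  by under eq_integral do rewrite !mul0e; rewrite integral0 ltxx.
have u_lty : (\int[lebesgue_rV R n]_x (u x `^ q)%:E < +oo)%E.
  have mq : measurable_fun [set: 'rV[R]_n] (fun x => (u x `^ q)%:E).
    apply/measurable_EFinP.
    exact: (measurableT_comp (@measurable_powR R q) mu_u).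
  rewrite -(integral_completed mq); last by move=> x; rewrite lee_fin powR_ge0.
  by apply: Lfun_integral_powR_lty => // x; exact: ltW.
have d0 : 0 < q - beta + 1 by lra.
have s1 : 1 < q / (q - beta + 1) by rewrite ltr_pdivlMr// mul1r; lra.
have K_lty : (\int[lebesgue_rV R n]_x K (sqn x) `^ (q / (q - beta + 1)) < +oo)%E.
  have s_exp : 0 < n%:R / (2 * (q / (q - beta + 1))) + (- n%:R + alpha) / 2 :> R.
    rewrite (_ : _ + _ = (alpha - n%:R * (beta - 1) / q) / 2); last first.
      by field; rewrite (gt_eqF d0) (gt_eqF q0).
    by rewrite divr_gt0// subr_gt0 ltr_pdivrMr// (mulrC alpha) -ltr_pdivrMr.
  have := integral_bprofile_lty s1 s_exp; set I := (\int[_]_x _)%E => Ify.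
  have E x : (K (sqn x) `^ (q / (q - beta + 1)) = (c `^ (q / (q - beta + 1)))%:E *
      @bprofile R n alpha (sqn x) `^ (q / (q - beta + 1)))%E.
    by rewrite poweRM ?lee_fin ?bprofile_ge0// poweR_EFin.
  under eq_integral do rewrite E.
  rewrite ge0_integralZl//.
  - have : (0 <= I)%E by apply: integral_ge0 => x _; exact: poweR_ge0.
    rewrite -/I; case: I Ify => // i _ _.
    by rewrite -EFinM ltry.
  - apply: measurable_fun_poweR.
    apply: (measurableT_comp (measurable_bprofile alpha)).
    exact: measurable_sqn.
  - by move=> x _; exact: poweR_ge0.
  - by rewrite lee_fin powR_ge0.
have K_ge0 r : (0 <= K r)%E by rewrite mule_ge0 ?bprofile_ge0// lee_fin.
have mK : measurable_fun [set: R] K.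
  by apply: measurable_funeM; exact: measurable_bprofile.
have K_le r s : r <= s -> (K s <= K r)%E.
  by move=> rs; rewrite lee_wpmul2l ?lee_fin// le_bprofile.
have K_lt r s : r < s -> (K r < +oo)%E -> (K s < K r)%E.
  move=> rs Kr; rewrite /K lte_pmul2l ?lte_fin//; apply: lt_bprofile => //.
  move: Kr; rewrite /K; case: (bprofile _ _) => [x| |]; rewrite ?ltry//.
  by rewrite gt0_muley ?lte_fin.
have K_lsc a r_ r : 0 <= a -> r_ @ \oo --> r ->
    (a%:E * K r <= limn_einf (fun k => a%:E * K (r_ k)))%E.
  move=> a0 rr; rewrite /K muleA -EFinM; under eq_fun do rewrite muleA -EFinM.
  by apply: bprofile_lsc => //; rewrite mulr_ge0.
apply: (@radial_decreasing R n u hn).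
- move=> e e1.
  exact: (moving_plane K_ge0 mK K_le K_lt K_lsc hbeta qbeta K_lty mu_u u0 u_eq u_lty e1).
- exact: (no_translation K_ge0 mK hbeta qbeta mu_u u0 u_eq u_lty).
Qed.
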